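(* Let $k \in \mathbb N$ and let $\phi \colon \mathcal H_{2k}^0 \to \mathcal H_{2k}^0$ be a map. Then the following are equivalent: (i) $\phi$ is (real) linear and $\phi(\mathcal{IH}_{2k}^0) \subset \mathcal{IH}_{2k}^0$; (ii) there exist $U \in \mathcal U_{2k}$ and $s \in \{-1,1\}$ such that either $\phi(A) = s\,UAU^\ast$ for all $A \in \mathcal H_{2k}^0$, or $k \ge 2$ and $\phi(A) = s\,U\overline{A}U^\ast$ for all $A \in \mathcal H_{2k}^0$.
   Context: $\mathcal H_n$ denotes the real vector space of $n\times n$ complex hermitian matrices, $\mathcal H_n^0 = \{A \in \mathcal H_n : \operatorname{tr} A = 0\}$, $\mathcal U_n$ the set of $n \times n$ complex unitary matrices, and $\mathcal{IH}_n^0 = \mathcal H_n^0 \cap \mathcal U_n$. $\overline{A}$ denotes the entrywise complex conjugate of $A$ and $A^\ast$ the conjugate transpose. *)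

(* Defs.v *)
From HB Require Import structures.
From mathcomp Require Import all_boot all_order all_algebra.
From mathcomp Require Import sesquilinear spectral.
From mathcomp Require Import complex reals.
Set Implicit Arguments. Unset Strict Implicit. Unset Printing Implicit Defensive.
Import Order.TTheory GRing.Theory Num.Theory.
Local Open Scope ring_scope.
Local Open Scope sesquilinear_scope.

Definition herm0 (R : realType) (n : nat) (A : 'M[R[i]]_n) : Prop :=
  A \is hermsymmx /\ \tr A = 0.

Definition iherm0 (R : realType) (n : nat) (A : 'M[R[i]]_n) : Prop :=
  herm0 A /\ A \is unitarymx.

Definition ctrmx (R : realType) (n : nat) (A : 'M[R[i]]_n) : 'M[R[i]]_n :=
  A ^t* .

Definition entconjmx (R : realType) (n : nat) (A : 'M[R[i]]_n) : 'M[R[i]]_n :=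
  map_mx Num.conj A.

(* Main.v *)
Require Import Defs.
From HB Require Import structures.
From mathcomp Require Import all_boot all_order all_algebra.
From mathcomp Require Import sesquilinear spectral.
From mathcomp Require Import complex reals.
From mathcomp Require Import ring zify.
Set Implicit Arguments. Unset Strict Implicit. Unset Printing Implicit Defensive.
Import Order.TTheory GRing.Theory Num.Theory.
Local Open Scope ring_scope.
Local Open Scope sesquilinear_scope.

(* Extend [phi] to a complex-linear [f] on all matrices that kills scalars; [f]
   commutes with the adjoint and maps hermitian traceless involutions to
   involutions.

   For a pair [x, y] of orthonormal vectors, [f] restricted to the traceless
   matrices on the plane [<x, y>] sends the three Pauli matrices to anticommuting
   operators with a common square [P(x, y)], and signs on orthogonal planes can
   be flipped independently, so images over orthogonal planes anticommute and the
   squares over an orthogonal decomposition add up to 1.  If such a map goes into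
   dimension [d > 0] then [2k <= d]: by induction on [k], an eigenvalue of [P]
   other than 0 and 1 would give, on its eigenspace, a rescaled map for [k - 1]
   commuting with the product of two anticommuting operators, whence
   [d >= 2 (2k - 2)] (for [k = 2] a third anticommuting operator improves this).
   So every [P(x, y)] is a projection; since [P(cx + sz, y) = s^2 P(z, y)] when
   [P(x, y) = 0], none of them vanishes.  For [d = 2k] the [P(x, y)] have rank 2
   and images over orthogonal planes multiply to 0.

   Write [h_ij = f (E_ii - E_jj)].  For [2k >= 4], [F_i = h_ij h_ik] does not
   depend on [j, k]; the [F_i] are orthogonal projections of rank one and
   [h_ij = c (F_i - F_j)] with [c = 1] or [c = -1].  After a unitary conjugation
   and a change of sign, [f] fixes the traceless diagonal matrices, and
   [f E_ij = a_ij E_ij + b_ij E_ji].  The products [f E_ij * f E_il = 0] force all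
   [b_ij = 0] or all [a_ij = 0]; the coefficients left form a unimodular
   cocycle, that is, come from a diagonal unitary matrix. *)

(** * Linear maps and adjoints *)

Section LinearMap.
Variables (K : pzRingType) (U V : lmodType K) (f : U -> V) (fl : linear f).

Lemma linfunD u v : f (u + v) = f u + f v.
Proof. by have := fl 1 u v; rewrite !scale1r. Qed.

Lemma linfun0 : f 0 = 0.
Proof. by apply: (addrI (f 0)); rewrite -linfunD !addr0. Qed.

Lemma linfunZ a u : f (a *: u) = a *: f u.
Proof. by have := fl a u 0; rewrite !addr0 linfun0 addr0. Qed.

Lemma linfunN u : f (- u) = - f u.
Proof. by rewrite -scaleN1r linfunZ scaleN1r. Qed.

Lemma linfunB u v : f (u - v) = f u - f v.
Proof. by rewrite linfunD linfunN. Qed.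

Lemma linfun_sum I (r : seq I) (P : pred I) (F : I -> U) :
  f (\sum_(i <- r | P i) F i) = \sum_(i <- r | P i) f (F i).
Proof. exact: (big_morph f linfunD linfun0). Qed.

End LinearMap.

Section Adjoint.
Variable C : numClosedFieldType.

Lemma trmxCD m n (A B : 'M[C]_(m, n)) : (A + B)^t* = A^t* + B^t*.
Proof. by rewrite linearD /= map_mxD. Qed.

Lemma trmxCN m n (A : 'M[C]_(m, n)) : (- A)^t* = - A^t*.
Proof. by rewrite linearN /= map_mxN. Qed.

Lemma trmxCB m n (A B : 'M[C]_(m, n)) : (A - B)^t* = A^t* - B^t*.
Proof. by rewrite trmxCD trmxCN. Qed.

Lemma trmxCZ m n c (A : 'M[C]_(m, n)) : (c *: A)^t* = c^* *: A^t*.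
Proof. by rewrite linearZ /= map_mxZ. Qed.

Lemma trmxC_mul m n p (A : 'M[C]_(m, n)) (B : 'M_(n, p)) :
  (A *m B)^t* = B^t* *m A^t*.
Proof. by rewrite trmx_mul map_mxM. Qed.

Lemma trmxC0 m n : (0 : 'M[C]_(m, n))^t* = 0.
Proof. by rewrite trmx0 map_mx0. Qed.

Lemma trmxC_eq0 m n (A : 'M[C]_(m, n)) : A^t* = 0 -> A = 0.
Proof. by move=> A0; rewrite -[A]trmxCK A0 trmxC0. Qed.

Lemma trmxC1 n : (1%:M : 'M[C]_n)^t* = 1%:M.
Proof. by rewrite trmx1 map_mx1. Qed.

Lemma trmxC_delta m n i j : (delta_mx i j : 'M[C]_(m, n))^t* = delta_mx j i.
Proof. by rewrite trmx_delta map_delta_mx. Qed.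

Lemma mxtrace_delta n (i j : 'I_n) : \tr (delta_mx i j : 'M[C]_n) = (i == j)%:R.
Proof.
rewrite /mxtrace (bigD1 i) //= mxE eqxx /= big1 ?addr0 // => l /negPf li.
by rewrite mxE li.
Qed.

Lemma trmxC_block m1 m2 n1 n2 (A : 'M[C]_(m1, n1)) (B : 'M_(m1, n2))
    (D : 'M_(m2, n1)) (E : 'M_(m2, n2)) :
  (block_mx A B D E)^t* = block_mx (A^t* ) (D^t* ) (B^t* ) (E^t* ).
Proof. by rewrite tr_block_mx map_block_mx. Qed.

Lemma mulct_eq0 m n (A : 'M[C]_(m, n)) : A *m A^t* = 0 -> A = 0.
Proof.
move=> A0; apply/matrixP=> i j; rewrite mxE.
have /eqP := congr1 (fun M : 'M_m => M i i) A0; rewrite !mxE.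
rewrite psumr_eq0 => [|l _]; last by rewrite !mxE mul_conjC_ge0.
by move/allP/(_ j (mem_index_enum _)); rewrite !mxE mul_conjC_eq0 => /eqP.
Qed.

Lemma herm_sq_eq0 n (A : 'M[C]_n) : A^t* = A -> A *m A = 0 -> A = 0.
Proof. by move=> hA A0; apply: mulct_eq0; rewrite hA. Qed.

Lemma exists_orthonormal_basis m n (A : 'M[C]_(m, n)) r : \rank A = r ->
  exists2 B : 'M[C]_(r, n), B \is unitarymx & (B :=: A)%MS.
Proof.
move=> <-; exists (schmidt (row_base A)).
  exact: schmidt_unitarymx (rank_leq_col A).
by apply: eqmx_trans (eqmx_schmidt_free (row_base_free A)) (eq_row_base A).
Qed.

Lemma unitary_completion m p (V : 'M[C]_(m, m + p)) : V \is unitarymx ->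
  exists W : 'M[C]_(p, m + p), [/\ W \is unitarymx, V *m W^t* = 0 &
    col_mx V W \is unitarymx].
Proof.
move=> uV; have [] := @exists_orthonormal_basis _ _ (orthomx Num.conj 1%:M V) p.
  by rewrite rank_ortho mxrank_unitary // addKn.
move=> W uW eW; have WV : W *m V^t* = 0.
  by apply/eqP; rewrite -orthomx1E -eW submx_refl.
have VW : V *m W^t* = 0.
  by apply: trmxC_eq0; rewrite trmxC_mul trmxCK WV.
exists W; split=> //; apply/unitarymxP.
rewrite tr_col_mx map_row_mx mul_col_row WV VW.
by rewrite !(unitarymxP _) // -scalar_mx_block.
Qed.

Lemma unitary_mulct n (U : 'M[C]_n) : U \is unitarymx -> U^t* *m U = 1%:M.
Proof. by rewrite -trmxC_unitary => /unitarymxP; rewrite trmxCK. Qed.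

(** In a full rank factorization [P = c r], idempotency forces [r c = 1], a unit matrix of size the
    rank, and the trace is cyclic. *)
Lemma idem_trace n (P : 'M[C]_n) : P *m P = P -> \tr P = (\rank P)%:R.
Proof.
move=> PP; rewrite -[in LHS](mulmx_base P) mxtrace_mulC.
have [B BK] := row_freeP (row_base_free P).
have [A AK] : exists A, A *m col_base P = 1%:M.
  by exists (pinvmx (col_base P)); apply: mulVpmx; apply: col_base_full.
suff -> : row_base P *m col_base P = 1%:M by rewrite mxtrace1.
move: (col_base P) (row_base P) (mulmx_base P) AK BK => c r PE AK BK.
have : A *m (c *m r *m (c *m r)) *m B = A *m (c *m r) *m B by rewrite PE PP.
by rewrite !mulmxA AK mul1mx -!mulmxA BK !mulmx1.
Qed.

(** The row space is spanned by one unit row [B], so [F = D B]; being a hermitian idempotent, [F]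
    fixes the adjoint of [B], which identifies [D]. *)
Lemma projection_rank1 n (F : 'M[C]_n) : F^t* = F -> F *m F = F -> \tr F = 1 ->
  exists2 v : 'cV[C]_n, F = v *m v^t* & v^t* *m v = 1%:M.
Proof.
move=> hF FF trF; have rF : \rank F = 1%N.
  by apply/eqP; rewrite -(eqr_nat C) -idem_trace // trF.
have [B uB eB] := exists_orthonormal_basis rF.
have BF : B *m F = B.
  have /submxP[D ->] : (B <= F)%MS by rewrite eB.
  by rewrite -mulmxA FF.
have /submxP[D FD] : (F <= B)%MS by rewrite eB.
exists (B^t* ); last by rewrite trmxCK; apply/unitarymxP.
rewrite trmxCK FD; congr (_ *m _).
have : F *m B^t* = B^t* by rewrite -[in LHS]hF -trmxC_mul BF.
by rewrite FD -mulmxA (unitarymxP uB) mulmx1.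
Qed.

End Adjoint.

(** * Compression to invariant subspaces *)

Section Compression.
Variable C : numClosedFieldType.

Definition compress r d (B : 'M[C]_(r, d)) (X : 'M_d) := B *m X *m B^t*.

(** For orthonormal rows [B], the row space of [B] is invariant under [X]; this form serves as a
    rewriting rule. *)
Definition stabilizes r d (B : 'M[C]_(r, d)) (X : 'M_d) :=
  B *m X = compress B X *m B.

Lemma compress_ct r d (B : 'M_(r, d)) X :
  compress B (X^t* ) = (compress B X)^t*.
Proof. by rewrite /compress !trmxC_mul trmxCK mulmxA. Qed.

Lemma compressM r d (B : 'M_(r, d)) X Y : stabilizes B X ->
  compress B (X *m Y) = compress B X *m compress B Y.
Proof. by move=> sX; rewrite {1}/compress mulmxA sX /compress !mulmxA. Qed.

Lemma compress_linear r d (B : 'M_(r, d)) : linear (compress B).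
Proof.
move=> a X Y; rewrite /compress mulmxDr mulmxDl.
by rewrite -scalemxAr -scalemxAl.
Qed.

Lemma compress_scalar r d (B : 'M_(r, d)) a : B \is unitarymx ->
  compress B a%:M = a%:M.
Proof.
by move=> uB; rewrite /compress mul_mx_scalar -scalemxAl (unitarymxP uB) scalemx1.
Qed.

Lemma compress_comp q r d (B' : 'M_(q, r)) (B : 'M_(r, d)) X :
  compress B' (compress B X) = compress (B' *m B) X.
Proof. by rewrite /compress trmxC_mul !mulmxA. Qed.

Lemma stabilizes_comp q r d (B' : 'M_(q, r)) (B : 'M_(r, d)) X :
  stabilizes B X -> stabilizes B' (compress B X) -> stabilizes (B' *m B) X.
Proof.
by rewrite /stabilizes -compress_comp -mulmxA => -> sX; rewrite mulmxA sX mulmxA.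
Qed.

(** Whatever commutes with [P] preserves its eigenspaces, so relations among such operators survive
    compression to one of them. *)
Lemma eigen_isometry d (P : 'M[C]_d) lam :
  exists r (B : 'M[C]_(r, d)), [/\ r = \rank (eigenspace P lam), B \is unitarymx,
    B *m P = lam *: B & forall X, X *m P = P *m X -> stabilizes B X].
Proof.
have [B uB eB] := @exists_orthonormal_basis C _ _ (eigenspace P lam) _ erefl.
exists _, B; have BP : B *m P = lam *: B by apply/eigenspaceP; rewrite eB.
split=> // X XP; have /submxP[D BX] : (B *m X <= B)%MS.
  by rewrite eB; apply/eigenspaceP; rewrite -mulmxA XP mulmxA BP scalemxAl.
rewrite /stabilizes /compress BX -(mulmxA D B).
by rewrite (unitarymxP uB) mulmx1.
Qed.

Lemma herm_eigen_real d (P : 'M[C]_d) lam : P^t* = P -> eigenvalue P lam ->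
  lam^* = lam.
Proof.
move=> hP elam; have [r [B [rE uB BP _]]] := eigen_isometry P lam.
have /matrixP E : (compress B P)^t* = compress B P by rewrite -compress_ct hP.
have r0 : (0 < r)%N by rewrite rE lt0n mxrank_eq0.
have := E (Ordinal r0) (Ordinal r0).
rewrite /compress BP -scalemxAl (unitarymxP uB).
by rewrite trmxCZ trmxC1 !mxE eqxx !mulr1.
Qed.

(* The isometry is onto an eigenspace of [i a b]; [a] maps it to the orthogonal
   eigenspace for the opposite eigenvalue. *)
Lemma anticommuting_halve d (a b : 'M[C]_d) lam nu : (0 < d)%N ->
  lam != 0 -> nu != 0 ->
  a^t* = a -> b^t* = b -> a *m a = lam%:M -> b *m b = nu%:M ->
  a *m b = - (b *m a) ->
  exists r (B : 'M[C]_(r, d)), [/\ (0 < r)%N, (r * 2 <= d)%N, B \is unitarymx &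
    forall X, X *m a = - (a *m X) -> X *m b = - (b *m X) -> stabilizes B X].
Proof.
move=> d0 lam0 nu0 ha hb aa bb ab; pose N := 'i *: (a *m b).
have hN : N^t* = N.
  by rewrite /N trmxCZ trmxC_mul ha hb conjCi ab scaleNr scalerN.
have NN : N *m N = (lam * nu)%:M.
  rewrite /N -scalemxAl -scalemxAr scalerA -expr2 sqrCi scaleN1r.
  rewrite mulmxA -(mulmxA a b a) -[b *m a]opprK -ab mulmxN mulNmx mulmxA aa.
  by rewrite opprK -mulmxA bb -scalar_mxM.
have [mu emu] := eigenvalue_closed N d0.
have [r [B [rE uB BN sB]]] := eigen_isometry N mu.
have r0 : (0 < r)%N by rewrite rE lt0n mxrank_eq0.
have rmu := herm_eigen_real hN emu.
have mu0 : mu != 0.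
  apply: contraNneq (mulf_neq0 lam0 nu0) => mu0; have : B *m (N *m N) = 0.
    by rewrite mulmxA BN mu0 scale0r mul0mx.
  rewrite NN mul_mx_scalar => /(congr1 (mulmx^~ (B^t* ))).
  rewrite -scalemxAl (unitarymxP uB) mul0mx.
  move/matrixP/(_ (Ordinal r0) (Ordinal r0)); rewrite !mxE eqxx mulr1.
  by move->.
have aN : a *m N = - (N *m a).
  rewrite /N -scalemxAr -scalemxAl -mulmxA -[b *m a]opprK -ab.
  by rewrite mulmxN scalerN opprK.
(* Moving [N] across [a] in [B N a] and letting it act on the adjoint of [B], with [mu] real, gives
   [mu x = - mu x] for the compression [x] of [a]. *)
have BaB : B *m a *m B^t* = 0.
  have NB : N *m B^t* = mu *: B^t* by rewrite -[in LHS]hN -trmxC_mul BN trmxCZ rmu.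
  have E : mu *: (B *m a *m B^t* ) = - (mu *: (B *m a *m B^t* )).
    rewrite {1}scalemxAl {1}scalemxAl -BN -(mulmxA B N a) -[N *m a]opprK -aN.
    by rewrite mulmxN mulNmx mulmxA -(mulmxA _ N) NB -scalemxAr.
  apply/eqP; move/eqP: E; rewrite -subr_eq0 opprK -mulr2n -scaler_nat scalerA.
  by rewrite scaler_eq0 mulf_eq0 pnatr_eq0 (negPf mu0).
exists r, B; split=> //; last first.
  move=> X Xa Xb; apply: sB; rewrite /N -scalemxAr -scalemxAl; congr (_ *: _).
  by rewrite mulmxA Xa mulNmx -(mulmxA a X b) Xb mulmxN opprK mulmxA.
have : row_free (col_mx B (B *m a)).
  apply/row_freeP; exists (row_mx (B^t* ) (lam^-1 *: (a *m B^t* ))).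
  rewrite mul_col_row -!scalemxAr (unitarymxP uB) !mulmxA BaB scaler0.
  rewrite -(mulmxA B a a) aa mul_mx_scalar -scalemxAl (unitarymxP uB) scalerA.
  by rewrite mulVf // scale1r -scalar_mx_block.
by rewrite -row_leq_rank => /leq_trans/(_ (rank_leq_col _)); rewrite muln2 addnn.
Qed.

End Compression.

(** * Linear maps with constant square on hermitian involutions *)

Section InvolutionMap.
Variable C : numClosedFieldType.

Definition herm_inv n (A : 'M[C]_n) :=
  [/\ A^t* = A, \tr A = 0 & A *m A = 1%:M].

(** The common square [P] is arbitrary because restricting a map to a diagonal block may replace the
    square 1 by another operator. *)
Definition inv_map m d (f : 'M[C]_m -> 'M[C]_d) (P : 'M_d) :=
  [/\ linear f, forall M, f (M^t* ) = (f M)^t* &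
      forall A, herm_inv A -> f A *m f A = P].

Lemma herm_invN n (A : 'M[C]_n) : herm_inv A -> herm_inv (- A).
Proof.
case=> hA tA AA; split; first by rewrite trmxCN hA.
  by rewrite linearN /= tA oppr0.
by rewrite mulNmx mulmxN opprK.
Qed.

Lemma mulmx_lincomb n (A B : 'M[C]_n) (c s : C) :
  (c *: A + s *: B) *m (c *: A + s *: B) =
  c ^+ 2 *: (A *m A) + s ^+ 2 *: (B *m B) + (c * s) *: (A *m B + B *m A).
Proof.
rewrite mulmxDl !mulmxDr -!scalemxAl -!scalemxAr !scalerA scalerDr -!expr2.
by rewrite (mulrC s c) [X in _ + X = _]addrC addrACA.
Qed.

Lemma herm_inv_rot n (A B : 'M[C]_n) (c s : C) : herm_inv A -> herm_inv B ->
  A *m B = - (B *m A) -> c^* = c -> s^* = s -> c ^+ 2 + s ^+ 2 = 1 ->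
  herm_inv (c *: A + s *: B).
Proof.
move=> [hA tA AA] [hB tB BB] AB hc hs cs; split.
- by rewrite trmxCD !trmxCZ hA hB hc hs.
- by rewrite linearD /= !linearZ /= tA tB !mulr0 addr0.
- rewrite mulmx_lincomb AA BB AB addNr scaler0 addr0 -scalerDl cs.
  by rewrite scale1r.
Qed.

(** With [rot_sin], a rational point of the unit circle whose coordinates are both nonzero. *)
Definition rot_cos : C := 3%:R / 5%:R.
Definition rot_sin : C := 4%:R / 5%:R.

Lemma rot_cos_real : rot_cos^* = rot_cos.
Proof. by apply/CrealP; rewrite rpred_div ?realn. Qed.

Lemma rot_sin_real : rot_sin^* = rot_sin.
Proof. by apply/CrealP; rewrite rpred_div ?realn. Qed.

Lemma rot_circle : rot_cos ^+ 2 + rot_sin ^+ 2 = 1.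
Proof.
rewrite /rot_cos /rot_sin !expr_div_n -mulrDl -!natrX -natrD.
by rewrite divff // pnatr_eq0.
Qed.

Lemma rot_cos_neq0 : rot_cos != 0.
Proof. by rewrite mulf_neq0 ?invr_neq0 ?pnatr_eq0. Qed.

Lemma rot_sin_neq0 : rot_sin != 0.
Proof. by rewrite mulf_neq0 ?invr_neq0 ?pnatr_eq0. Qed.

(** The rotation [c A + s B] is again a hermitian involution, so its image has square [P] too;
    comparing squares leaves [c s] times the anticommutator, and [c s] is nonzero. *)
Lemma inv_map_anticomm m d (f : 'M[C]_m -> 'M[C]_d) P A B : inv_map f P ->
  herm_inv A -> herm_inv B -> A *m B = - (B *m A) ->
  f A *m f B = - (f B *m f A).
Proof.
move=> [fl _ fP] iA iB AB.
have := fP _ (herm_inv_rot iA iB AB rot_cos_real rot_sin_real rot_circle).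
rewrite (linfunD fl) !(linfunZ fl) mulmx_lincomb !fP // -scalerDl rot_circle scale1r.
move/(canRL (addKr _)); rewrite addNr => /eqP; rewrite scaler_eq0 mulf_eq0.
by rewrite (negPf rot_cos_neq0) (negPf rot_sin_neq0) /= addr_eq0 => /eqP.
Qed.

Lemma inv_map_sq_pos m d (f : 'M[C]_m -> 'M[C]_d) (mu : C) (A : 'M_m) : inv_map f mu%:M ->
  herm_inv A -> (0 < d)%N -> 0 <= mu.
Proof.
move=> [_ fs fP] iA d0; have := fP _ iA; case: (iA) => hA _ _.
rewrite -{2}hA fs => /matrixP/(_ (Ordinal d0) (Ordinal d0)).
rewrite !mxE eqxx mulr1n => <-; apply: sumr_ge0 => i _.
by rewrite !mxE mul_conjC_ge0.
Qed.

(** Divides by the square root of [mu]; positivity of [mu] makes this factor real, so the rescaled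
    map still commutes with the adjoint. *)
Lemma inv_map_normalize m d (f : 'M[C]_m -> 'M[C]_d) (mu : C) (A : 'M_m) :
  inv_map f mu%:M -> herm_inv A -> (0 < d)%N -> mu != 0 ->
  exists2 s, s != 0 & inv_map (fun M => s *: f M) 1%:M.
Proof.
move=> fH iA d0 mu0; have mu_ge0 := inv_map_sq_pos fH iA d0.
case: fH => fl fs fP; exists (sqrtC mu)^-1; first by rewrite invr_eq0 sqrtC_eq0.
split=> [a M N|M|X iX].
- by rewrite fl scalerDr !scalerA mulrC.
- rewrite fs trmxCZ; congr (_ *: _); apply/esym/CrealP.
  by rewrite realV ger0_real // sqrtC_ge0.
- rewrite -scalemxAl -scalemxAr scalerA -invfM -expr2 sqrtCK fP // scale_scalar_mx.
  by rewrite mulVf.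
Qed.

Lemma inv_map_compress m d r (f : 'M[C]_m -> 'M[C]_d) P (B : 'M[C]_(r, d)) :
  inv_map f P -> (forall A, herm_inv A -> stabilizes B (f A)) ->
  inv_map (fun M => compress B (f M)) (compress B P).
Proof.
move=> [fl fs fP] sB; split=> [a M N|M|A iA].
- by rewrite fl compress_linear.
- by rewrite fs compress_ct.
- by rewrite -compressM ?fP //; apply: sB.
Qed.

End InvolutionMap.

(** * Pauli matrices and block matrices *)

Ltac mul_delta2 := rewrite ?(mulmxDl, mulmxDr, mulmxN, mulNmx)
  !mul_delta_mx_cond /= ?(mulr1n, mulr0n, oppr0, addr0, add0r, subr0, sub0r, opprK).

Section Pauli.
Variable C : numClosedFieldType.

Definition pauli_z : 'M[C]_2 := delta_mx 0 0 - delta_mx 1 1.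
Definition pauli_x : 'M[C]_2 := delta_mx 0 1 + delta_mx 1 0.
Definition pauli_y : 'M[C]_2 := 'i *: (delta_mx 1 0 - delta_mx 0 1).

Lemma one2 : 1%:M = delta_mx 0 0 + delta_mx 1 1 :> 'M[C]_2.
Proof.
apply/matrixP=> -[[|[|?]] ?] // -[[|[|?]] ?] //; rewrite !mxE /=; first [exact: addr0 | by rewrite add0r | by rewrite addr0].
Qed.

Lemma delta2_sum (M : 'M[C]_2) : M = M 0 0 *: delta_mx 0 0 + M 0 1 *: delta_mx 0 1
  + M 1 0 *: delta_mx 1 0 + M 1 1 *: delta_mx 1 1.
Proof.
rewrite [LHS]matrix_sum_delta !big_ord_recl !big_ord0 !addr0 !addrA.
by rewrite (_ : lift ord0 ord0 = 1) //; apply: val_inj.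
Qed.

Lemma pauli_z_inv : herm_inv pauli_z.
Proof.
split; rewrite /pauli_z.
- by rewrite trmxCB !trmxC_delta.
- by rewrite linearB /= !mxtrace_delta subrr.
- by mul_delta2; rewrite -one2.
Qed.

Lemma pauli_x_inv : herm_inv pauli_x.
Proof.
split; rewrite /pauli_x.
- by rewrite trmxCD !trmxC_delta addrC.
- by rewrite linearD /= !mxtrace_delta addr0.
- by mul_delta2; rewrite one2.
Qed.

Lemma pauli_y_inv : herm_inv pauli_y.
Proof.
split; rewrite /pauli_y.
- by rewrite trmxCZ trmxCB !trmxC_delta conjCi scaleNr -scalerN opprB.
- by rewrite linearZ linearB /= !mxtrace_delta subrr mulr0.
- rewrite -scalemxAl -scalemxAr scalerA -expr2 sqrCi scaleN1r.
  by mul_delta2; rewrite opprD !opprK one2 addrC.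
Qed.

Lemma pauli_zx : pauli_z *m pauli_x = - (pauli_x *m pauli_z).
Proof. by rewrite /pauli_z /pauli_x; mul_delta2; rewrite opprD opprK. Qed.

Lemma pauli_zy : pauli_z *m pauli_y = - (pauli_y *m pauli_z).
Proof.
by rewrite /pauli_z /pauli_y -!scalemxAl -!scalemxAr -scalerN; mul_delta2; rewrite ?opprD ?opprK // addrC.
Qed.

Lemma pauli_xy : pauli_x *m pauli_y = - (pauli_y *m pauli_x).
Proof.
by rewrite /pauli_x /pauli_y -!scalemxAl -!scalemxAr -scalerN; mul_delta2; rewrite ?opprD ?opprK // addrC.
Qed.

Lemma pauli_span (M : 'M[C]_2) : \tr M = 0 ->
  M = M 0 0 *: pauli_z + ((M 0 1 + M 1 0) / 2) *: pauli_x
      + ((M 1 0 - M 0 1) / (2 * 'i)) *: pauli_y.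
Proof.
rewrite /mxtrace !big_ord_recl big_ord0 addr0.
rewrite (_ : lift ord0 ord0 = 1); last exact: val_inj.
move/eqP; rewrite addrC addr_eq0 => /eqP M11; rewrite [LHS]delta2_sum M11.
have i0 : 'i != 0 :> C by rewrite neq0Ci.
rewrite /pauli_z /pauli_x /pauli_y scalerBr scalerDr scalerA scalerBr scaleNr.
have -> : (M 1 0 - M 0 1) / (2 * 'i) * 'i = (M 1 0 - M 0 1) / 2 by field.
set a := M 0 0; set b := M 0 1; set c := M 1 0.
apply/matrixP=> i j; rewrite !mxE.
set x00 := (_ : bool)%:R.
by field.
Qed.

(** The Pauli matrices are hermitian involutions and span the traceless matrices of size 2 over
    [C]. *)
Lemma pauli_linear_eq0 (W : lmodType C) (h : 'M[C]_2 -> W) X : linear h ->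
  (forall A, herm_inv A -> h A = 0) -> \tr X = 0 -> h X = 0.
Proof.
move=> hl h0 trX; rewrite (pauli_span trX) !(linfunD hl) (linfunZ hl _ pauli_z) (linfunZ hl _ pauli_x).
rewrite (linfunZ hl _ pauli_y) (h0 _ pauli_z_inv) (h0 _ pauli_x_inv) (h0 _ pauli_y_inv).
by rewrite !scaler0 !addr0.
Qed.

End Pauli.

Section Split.
Variable C : numClosedFieldType.

Definition ulblock m1 m2 (X : 'M[C]_m1) : 'M[C]_(m1 + m2) := block_mx X 0 0 0.
Definition drblock m1 m2 (Y : 'M[C]_m2) : 'M[C]_(m1 + m2) := block_mx 0 0 0 Y.

Lemma ulblock_linear m1 m2 : linear (@ulblock m1 m2).
Proof.
by move=> a X Y; rewrite /ulblock scale_block_mx add_block_mx !scaler0 !addr0.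
Qed.

Lemma drblock_linear m1 m2 : linear (@drblock m1 m2).
Proof.
by move=> a X Y; rewrite /drblock scale_block_mx add_block_mx !scaler0 !addr0.
Qed.

Lemma ulblock_ct m1 m2 X : @ulblock m1 m2 (X^t* ) = (ulblock m2 X)^t*.
Proof. by rewrite /ulblock trmxC_block !trmxC0. Qed.

Lemma drblock_ct m1 m2 Y : @drblock m1 m2 (Y^t* ) = (drblock m1 Y)^t*.
Proof. by rewrite /drblock trmxC_block !trmxC0. Qed.

Lemma blocks_add m1 m2 (X : 'M[C]_m1) (Y : 'M[C]_m2) :
  ulblock m2 X + drblock m1 Y = block_mx X 0 0 Y.
Proof. by rewrite /ulblock /drblock add_block_mx !addr0 add0r. Qed.

Lemma herm_inv_block m1 m2 (X : 'M[C]_m1) (Y : 'M[C]_m2) :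
  herm_inv X -> herm_inv Y -> herm_inv (ulblock m2 X + drblock m1 Y).
Proof.
move=> [hX tX XX] [hY tY YY]; rewrite blocks_add; split.
- by rewrite trmxC_block hX hY !trmxC0.
- by rewrite mxtrace_block tX tY addr0.
- by rewrite mulmx_block XX YY !mulmx0 !mul0mx !addr0 add0r -scalar_mx_block.
Qed.

(** The diagonal matrix with alternating entries 1 and -1, which provides a hermitian traceless
    involution in every even size. *)
Fixpoint std_inv k : 'M[C]_(k.*2) :=
  if k is k'.+1 then (ulblock k'.*2 (pauli_z C) + drblock 2 (std_inv k') : 'M_(k'.+1.*2))
  else 0.

Lemma std_invP k : herm_inv (std_inv k).
Proof.
elim: k => [|k IHk]; last exact: herm_inv_block (pauli_z_inv C) IHk.
by split; [rewrite trmxC0 | rewrite mxtrace0 | apply/matrixP=> -[]].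
Qed.

(** The dimension bound for one source size, in the form used as induction hypothesis. *)
Definition min_dim m := forall d (f : 'M[C]_m -> 'M[C]_d),
  inv_map f 1%:M -> (0 < d)%N -> (m <= d)%N.

Lemma min_dim2 : min_dim 2.
Proof.
move=> d f fH d0; have [fl fs fP] := fH.
have [||r [B [r0 rd _ _]]] := anticommuting_halve d0 (oner_neq0 C) (oner_neq0 C) _ _
  (fP _ (pauli_x_inv C)) (fP _ (pauli_y_inv C)) (inv_map_anticomm fH (pauli_x_inv C) (pauli_y_inv C) (pauli_xy C)).
- by rewrite -fs; case: (pauli_x_inv C) => ->.
- by rewrite -fs; case: (pauli_y_inv C) => ->.
- by move: r0 rd; lia.
Qed.

(** The images of [pauli_x] and [pauli_y] halve the space; on the half, the compressions of
    [f (pauli_z C)] and [T] still anticommute with nonzero scalar squares and halve it again. *)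
Lemma min_dim2_anticomm d (f : 'M[C]_2 -> 'M[C]_d) T lam :
  inv_map f 1%:M -> (0 < d)%N -> T^t* = T -> T *m T = lam%:M -> lam != 0 ->
  (forall A, herm_inv A -> T *m f A = - (f A *m T)) -> (4 <= d)%N.
Proof.
move=> fH d0 hT TT lam0 Tf; have [fl fs fP] := fH.
have hf A : herm_inv A -> (f A)^t* = f A by case=> hA _ _; rewrite -fs hA.
have iz := pauli_z_inv C; have ix := pauli_x_inv C; have iy := pauli_y_inv C.
have [||r [B [r0 rd uB sB]]] := anticommuting_halve d0 (oner_neq0 C) (oner_neq0 C) _ _
  (fP _ ix) (fP _ iy) (inv_map_anticomm fH ix iy (pauli_xy C)); try exact: hf.
have sz_stab : stabilizes B (f (pauli_z C)).
  by apply: sB; apply: (inv_map_anticomm fH) => //; [apply: pauli_zx | apply: pauli_zy].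
have T_stab : stabilizes B T by apply: sB; apply: Tf.
have [|||||q [B' [q0 qr _ _]]] := @anticommuting_halve C r (compress B (f (pauli_z C)))
   (compress B T) 1 lam r0 (oner_neq0 C) lam0.
- by rewrite -compress_ct hf.
- by rewrite -compress_ct hT.
- by rewrite -compressM // fP // compress_scalar.
- by rewrite -compressM // TT compress_scalar.
- by rewrite -!compressM // Tf // (linfunN (compress_linear B)) opprK.
by move: q0 qr rd; lia.
Qed.

End Split.

(** * The square of the image of a plane *)

Section HermIdem.
Variable C : numClosedFieldType.

(** By the spectral theorem [P] is diagonal in a suitable basis, and every diagonal entry is an
    eigenvalue, hence equal to its square. *)
Lemma herm_idem n (P : 'M[C]_n) : P^t* = P ->
  (forall lam, eigenvalue P lam -> lam = 0 \/ lam = 1) -> P *m P = P.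
Proof.
move=> hP eP; have /orthomx_spectralP E : P \is normalmx.
  by apply/normalmxP; rewrite hP.
set U := spectralmx P in E; set D := spectral_diag P in E.
have uU : U \in unitmx by apply: spectral_unit.
clearbody U D.
have dD : diag_mx D *m diag_mx D = diag_mx D.
  rewrite mulmx_diag; congr diag_mx; apply/rowP=> i; rewrite mxE.
  suff /eP[Di|Di] : eigenvalue P (D 0 i) by rewrite Di ?mul0r ?mul1r.
  apply/eigenvalueP; exists (row i U).
    rewrite E -row_mul !mulmxA mulmxV // mul1mx.
    by rewrite row_mul row_diag_mx -scalemxAl -rowE.
  apply/eqP=> Ui0; have := row_mul i U (invmx U).
  rewrite mulmxV // Ui0 mul0mx => /rowP/(_ i); rewrite !mxE eqxx => /eqP.
  by rewrite oner_eq0.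
by rewrite E !mulmxA mulmxK // -(mulmxA _ (diag_mx D) (diag_mx D)) dD.
Qed.

(** The bound improves in presence of an extra anticommuting operator [T]. This serves the case
    [m = 2], where [2 m] reaches [m + 2] without exceeding it. *)
Definition min_dim_strict m := forall d (f : 'M[C]_m -> 'M[C]_d) T lam,
  inv_map f 1%:M -> (0 < d)%N -> T^t* = T -> T *m T = lam%:M -> lam != 0 ->
  (forall A, herm_inv A -> T *m f A = - (f A *m T)) -> (m < d)%N.

Lemma min_dim_strict2 : min_dim_strict 2.
Proof.
move=> d f T lam fH d0 hT TT lam0 Tf.
by apply: leq_trans (min_dim2_anticomm fH d0 hT TT lam0 Tf).
Qed.

End HermIdem.

Section SplitMap.
Variables (C : numClosedFieldType) (m d : nat) (f : 'M[C]_(2 + m) -> 'M[C]_d).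
Variables (Y0 : 'M[C]_m) (iY0 : herm_inv Y0).
Hypothesis fH : inv_map f 1%:M.

Let a X := f (ulblock m X).
Let b Y := f (drblock 2 Y).

Definition split_sq := f (ulblock m (pauli_z C)) *m f (ulblock m (pauli_z C)).
Let P := split_sq.

Lemma split_ct M : f (M^t* ) = (f M)^t*. Proof. by case: fH. Qed.

Lemma split_ul_herm X : herm_inv X -> (a X)^t* = a X.
Proof. by rewrite /a -split_ct -ulblock_ct => -[->]. Qed.

(** Both [X + Y] and [X - Y], placed on the two diagonal blocks, are hermitian involutions. Their
    images have the same square 1, which kills the anticommutator and leaves the sum of squares. *)
Lemma split_relations X Y : herm_inv X -> herm_inv Y ->
  a X *m a X + b Y *m b Y = 1%:M /\ a X *m b Y = - (b Y *m a X).
Proof.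
move=> iX iY; have [fl _ fP] := fH.
have := fP _ (herm_inv_block iX (herm_invN iY)).
rewrite (linfunN (@drblock_linear C 2 m)) (linfunD fl) (linfunN fl) -/(a X) -/(b Y).
have := mulmx_lincomb (a X) (b Y) 1 (-1).
rewrite !scale1r scaleN1r => ->; rewrite sqrrN expr1n !scale1r mul1r scaleN1r.
have := fP _ (herm_inv_block iX iY); rewrite (linfunD fl) -/(a X) -/(b Y).
have := mulmx_lincomb (a X) (b Y) 1 1; rewrite !scale1r => ->.
rewrite expr1n !scale1r mul1r scale1r => Ep Em.
have ab0 : a X *m b Y + b Y *m a X = 0.
  apply/eqP; have /eqP := etrans Ep (esym Em).
  rewrite (can_eq (addKr _)) -subr_eq0 opprK -mulr2n -scaler_nat scaler_eq0.
  by rewrite pnatr_eq0.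
by rewrite ab0 addr0 in Ep; split=> //; apply/eqP; rewrite -addr_eq0 ab0.
Qed.

(** The square of [a X] is 1 minus the square of [b Y0], hence does not depend on [X]. *)
Lemma split_ul : inv_map a P.
Proof.
have [fl _ _] := fH; split=> [c X Y|X|X iX].
- by rewrite /a ulblock_linear fl.
- by rewrite /a ulblock_ct split_ct.
- apply: (addIr (b Y0 *m b Y0)); rewrite (split_relations iX iY0).1.
  by rewrite (split_relations (pauli_z_inv C) iY0).1.
Qed.

Lemma split_dr : inv_map b (1%:M - P).
Proof.
have [fl _ _] := fH; split=> [c X Y|X|X iX].
- by rewrite /b drblock_linear fl.
- by rewrite /b drblock_ct split_ct.
- by rewrite -(split_relations (pauli_z_inv C) iX).1 addrC addKr.
Qed.

Lemma split_sq_herm : P^t* = P.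
Proof. by rewrite /P /split_sq trmxC_mul !(split_ul_herm (pauli_z_inv C)). Qed.

Lemma split_ul_comm X : herm_inv X -> a X *m P = P *m a X.
Proof.
by case: split_ul => _ _ aP iX; rewrite -(aP _ iX) mulmxA.
Qed.

Lemma split_dr_comm Y : herm_inv Y -> b Y *m P = P *m b Y.
Proof.
move=> iY; have [_ E] := split_relations (pauli_z_inv C) iY; rewrite /P /split_sq.
rewrite -/(a (pauli_z C)) -mulmxA E mulmxN (mulmxA _ (b Y)) E mulNmx opprK.
by rewrite mulmxA.
Qed.

(** On the eigenspace the images [b Y] have the nonzero square [1 - lam]; rescaled, they form a map
    to which [min_dim] applies. *)
Lemma split_eigen_dr lam : min_dim C m -> eigenvalue P lam -> lam != 1 ->
  (m <= \rank (eigenspace P lam))%N.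
Proof.
move=> Sm elam lam1; have [r [B [rE uB BP sB]]] := eigen_isometry P lam.
have r0 : (0 < r)%N by rewrite rE lt0n mxrank_eq0.
rewrite -rE.
have := inv_map_compress split_dr (fun Y iY => sB _ (split_dr_comm iY)).
have -> : compress B (1%:M - P) = (1 - lam)%:M.
  rewrite (linfunB (compress_linear B)) compress_scalar // /compress BP.
  by rewrite -scalemxAl (unitarymxP uB) scalemx1 raddfB.
case/inv_map_normalize/(_ iY0 r0) => [|s _ /Sm/(_ r0)//].
by rewrite subr_eq0 eq_sym.
Qed.

Lemma split_eigen_ul lam : eigenvalue P lam -> lam != 0 ->
  (2 <= \rank (eigenspace P lam))%N.
Proof.
move=> elam lam0; have [r [B [rE uB BP sB]]] := eigen_isometry P lam.
have r0 : (0 < r)%N by rewrite rE lt0n mxrank_eq0.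
rewrite -rE.
have := inv_map_compress split_ul (fun Y iY => sB _ (split_ul_comm iY)).
have -> : compress B P = lam%:M.
  by rewrite /compress BP -scalemxAl (unitarymxP uB) scalemx1.
by case/inv_map_normalize/(_ (pauli_z_inv C) r0 lam0) => s _ /min_dim2/(_ r0).
Qed.

(** For such [lam] both blocks act on the eigenspace with nonzero squares. The images of [pauli_x]
    and [pauli_y] halve it, and the second block survives on the half, of dimension [q >= m]; so
    [d >= 2 m]. *)
Lemma split_eigen_mid lam : (0 < m)%N -> min_dim C m -> (2 < m)%N \/ min_dim_strict C m ->
  eigenvalue P lam -> lam != 0 -> lam != 1 -> (m + 2 < d)%N.
Proof.
move=> m0 Sm Sm' elam lam0 lam1; have [r [B [rE uB BP sB]]] := eigen_isometry P lam.
have r0 : (0 < r)%N by rewrite rE lt0n mxrank_eq0.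
have rd : (r <= d)%N by rewrite -(mxrank_unitary uB) rank_leq_col.
have cP : compress B P = lam%:M.
  by rewrite /compress BP -scalemxAl (unitarymxP uB) scalemx1.
have aH := split_ul; have [al _ aP] := aH.
have ha X : herm_inv X -> (compress B (a X))^t* = compress B (a X).
  by move=> iX; rewrite -compress_ct split_ul_herm.
have aa X : herm_inv X -> compress B (a X) *m compress B (a X) = lam%:M.
  by move=> iX; rewrite -compressM ?aP //; apply: sB; apply: split_ul_comm.
have caN X Y : stabilizes B X -> stabilizes B Y -> X *m Y = - (Y *m X) ->
    compress B X *m compress B Y = - (compress B Y *m compress B X).
  by move=> sX sY XY; rewrite -!compressM // XY (linfunN (compress_linear B)).
have sa X : herm_inv X -> stabilizes B (a X) by move/split_ul_comm/sB.
have sb X : herm_inv X -> stabilizes B (b X) by move/split_dr_comm/sB.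
have iz := pauli_z_inv C; have ix := pauli_x_inv C; have iy := pauli_y_inv C.
have xy := inv_map_anticomm aH ix iy (pauli_xy C).
have [q [B' [q0 qr uB' sB']]] := anticommuting_halve r0 lam0 lam0 (ha _ ix) (ha _ iy)
  (aa _ ix) (aa _ iy) (caN _ _ (sa _ ix) (sa _ iy) xy).
have sbE Y : herm_inv Y -> stabilizes (B' *m B) (b Y).
  move=> iY; apply: stabilizes_comp; first exact: sb.
  apply: sB'; apply: caN; try by [apply: sa | apply: sb].
    by rewrite (split_relations ix iY).2 opprK.
  by rewrite (split_relations iy iY).2 opprK.
have uE : B' *m B \is unitarymx by apply: mul_unitarymx.
have := inv_map_compress split_dr sbE.
have EP : compress (B' *m B) P = lam%:M.
  by rewrite -compress_comp cP compress_scalar.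
rewrite (linfunB (compress_linear _)) compress_scalar // EP -raddfB /=.
case/inv_map_normalize/(_ iY0 q0) => [|s s0 gH]; first by rewrite subr_eq0 eq_sym.
have mq := Sm _ _ gH q0.
(* [2 m > m + 2] settles [m > 2]. Otherwise the image of [pauli_z] also acts on the half and
   anticommutes with the second block, which gives [q > m]. *)
case: Sm' => [|Sm']; first by move: mq qr rd; lia.
have szE : stabilizes (B' *m B) (a (pauli_z C)).
  apply: stabilizes_comp; first exact: sa.
  apply: sB'; apply: caN; try by apply: sa.
    exact: (inv_map_anticomm aH iz ix (pauli_zx C)).
  exact: (inv_map_anticomm aH iz iy (pauli_zy C)).
have := Sm' _ _ (compress (B' *m B) (a (pauli_z C))) lam gH q0 _ _ lam0.
rewrite -compress_ct split_ul_herm // -compressM // aP // EP.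
move=> /(_ erefl erefl) mq'; suff : (m < q)%N by move: m0 qr rd; lia.
apply: mq' => Y iY; rewrite -scalemxAl -scalemxAr -scalerN; congr (_ *: _).
rewrite -(compressM _ szE) -(compressM _ (sbE _ iY)) (split_relations iz iY).2.
by rewrite (linfunN (compress_linear _)).
Qed.

Lemma split_sq_idem : (0 < m)%N -> min_dim C m -> (2 < m)%N \/ min_dim_strict C m ->
  (d <= m + 2)%N -> P *m P = P.
Proof.
move=> m0 Sm Sm' dm; apply: (herm_idem split_sq_herm) => lam elam.
have [->|lam0] := eqVneq lam 0; first by left.
have [->|lam1] := eqVneq lam 1; first by right.
by have := split_eigen_mid m0 Sm Sm' elam lam0 lam1; rewrite ltnNge dm.
Qed.

End SplitMap.

(** * Frames *)

Section Frames.
Variable C : numClosedFieldType.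

(** For [V] with orthonormal rows: the operator with matrix [X] in the coordinates given by [V],
    extended by 0 on the orthogonal complement. *)
Definition conj_by p q (V : 'M[C]_(p, q)) (X : 'M_p) : 'M_q := V^t* *m X *m V.

Lemma conj_by_linear p q (V : 'M[C]_(p, q)) : linear (conj_by V).
Proof.
move=> a X Y; rewrite /conj_by mulmxDr mulmxDl.
by rewrite -scalemxAr -scalemxAl.
Qed.

Lemma conj_by_ct p q (V : 'M[C]_(p, q)) X : conj_by V (X^t* ) = (conj_by V X)^t*.
Proof. by rewrite /conj_by !trmxC_mul trmxCK mulmxA. Qed.

Lemma conj_by_ul p1 p2 q (V : 'M[C]_(p1, q)) (W : 'M_(p2, q)) X :
  conj_by (col_mx V W) (ulblock p2 X) = conj_by V X.
Proof.
rewrite /conj_by /ulblock tr_col_mx map_row_mx mul_row_block mul_row_col.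
by rewrite !mulmx0 !addr0 mul0mx addr0.
Qed.

Lemma conj_by_dr p1 p2 q (V : 'M[C]_(p1, q)) (W : 'M_(p2, q)) Y :
  conj_by (col_mx V W) (drblock p1 Y) = conj_by W Y.
Proof.
rewrite /conj_by /drblock tr_col_mx map_row_mx mul_row_block mul_row_col.
by rewrite !mulmx0 !add0r mul0mx add0r.
Qed.

Lemma herm_inv_conj n (U : 'M[C]_n) A : U \is unitarymx -> herm_inv A ->
  herm_inv (conj_by U A).
Proof.
move=> uU [hA tA AA]; split; first by rewrite -conj_by_ct hA.
  by rewrite /conj_by mxtrace_mulC mulmxA (unitarymxP uU) mul1mx.
rewrite /conj_by !mulmxA mulmxtVK // -(mulmxA _ A A) AA mulmx1.
exact: unitary_mulct.
Qed.

Lemma inv_map_conj n d (f : 'M[C]_n -> 'M[C]_d) P (U : 'M[C]_n) :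
  inv_map f P -> U \is unitarymx -> inv_map (fun M => f (conj_by U M)) P.
Proof.
move=> [fl fs fP] uU; split=> [a M M'|M|A iA].
- by rewrite conj_by_linear fl.
- by rewrite conj_by_ct fs.
- by apply: fP; apply: herm_inv_conj.
Qed.

Lemma col_mx_unitary p1 p2 q (V : 'M[C]_(p1, q)) (W : 'M_(p2, q)) :
  V \is unitarymx -> W \is unitarymx -> V *m W^t* = 0 -> col_mx V W \is unitarymx.
Proof.
move=> uV uW VW; have WV : W *m V^t* = 0.
  by apply: trmxC_eq0; rewrite trmxC_mul trmxCK VW.
apply/unitarymxP; rewrite tr_col_mx map_row_mx mul_col_row WV VW.
by rewrite !(unitarymxP _) // -scalar_mx_block.
Qed.

Lemma usubmx_unitary p1 p2 q (W : 'M[C]_(p1 + p2, q)) :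
  W \is unitarymx -> usubmx W \is unitarymx.
Proof.
move/unitarymxP; rewrite -{1 2}(vsubmxK W) tr_col_mx map_row_mx mul_col_row.
by rewrite (scalar_mx_block p1 p2) => /eq_block_mx[+ _ _ _]; move/unitarymxP.
Qed.

Lemma inv_map_eq p q (g h : 'M[C]_p -> 'M[C]_q) P : g =1 h -> inv_map g P ->
  inv_map h P.
Proof.
move=> gh [gl gs gP]; split=> [a M N|M|A iA].
- by rewrite -!gh gl.
- by rewrite -!gh gs.
- by rewrite -gh gP.
Qed.

Definition frame n (x y : 'rV[C]_n) : 'M[C]_(2, n) := col_mx x y.

Lemma frame_unitary n (x y : 'rV[C]_n) : x \is unitarymx -> y \is unitarymx ->
  x *m y^t* = 0 -> frame x y \is unitarymx.
Proof. exact: (@col_mx_unitary 1 1). Qed.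

Lemma col_mx_orth p1 p2 p3 p4 n (x : 'M[C]_(p1, n)) (y : 'M_(p2, n))
    (z : 'M_(p3, n)) (t : 'M_(p4, n)) :
  x *m z^t* = 0 -> x *m t^t* = 0 -> y *m z^t* = 0 -> y *m t^t* = 0 ->
  col_mx x y *m (col_mx z t)^t* = 0.
Proof.
move=> xz xt yz yt; rewrite tr_col_mx map_row_mx mul_col_row xz xt yz yt.
by rewrite block_mx0.
Qed.

Lemma frame_orth n (x y z t : 'rV[C]_n) :
  x *m z^t* = 0 -> x *m t^t* = 0 -> y *m z^t* = 0 -> y *m t^t* = 0 ->
  frame x y *m (frame z t)^t* = 0.
Proof. exact: (@col_mx_orth 1 1 1 1). Qed.

Lemma conj_by_delta p q (V : 'M[C]_(p, q)) i j :
  conj_by V (delta_mx i j) = (row i V)^t* *m row j V.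
Proof.
rewrite /conj_by -(mul_delta_mx (0 : 'I_1)) mulmxA -(mulmxA _ _ V).
by rewrite -rowE -(trmxC_delta _ 0 i) -trmxC_mul -rowE.
Qed.

Lemma row_frame0 n (x y : 'rV[C]_n) : row 0 (frame x y) = x.
Proof.
by apply/rowP=> j; rewrite !mxE; case: splitP => // l _; rewrite (ord1 l).
Qed.

Lemma row_frame1 n (x y : 'rV[C]_n) : row 1 (frame x y) = y.
Proof.
by apply/rowP=> j; rewrite !mxE; case: splitP => [[[]]|l _] //; rewrite (ord1 l).
Qed.

Lemma frame_rows n (V : 'M[C]_(2, n)) : V = frame (row 0 V) (row 1 V).
Proof.
apply/row_matrixP=> -[[|[|?]] ?] //.
  by rewrite (_ : Ordinal _ = 0) ?row_frame0 //; apply: val_inj.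
by rewrite (_ : Ordinal _ = 1) ?row_frame1 //; apply: val_inj.
Qed.

Lemma unitary_rowP p q (V : 'M[C]_(p, q)) i j : V \is unitarymx ->
  row i V *m (row j V)^t* = (i == j)%:R%:M.
Proof.
move=> uV; rewrite (rowE j) trmxC_mul trmxC_delta mulmxA -row_mul (unitarymxP uV) row1.
apply/matrixP=> a b; rewrite mul_delta_mx_cond !mxE (ord1 a) (ord1 b) eqxx.
by case: (i == j); rewrite ?mxE.
Qed.

Lemma conj_by_diag n (U : 'M[C]_n) (e : 'rV_n) :
  conj_by U (diag_mx e) = \sum_i e 0 i *: ((row i U)^t* *m row i U).
Proof.
rewrite diag_mx_sum_delta (linfun_sum (conj_by_linear U)); apply: eq_bigr => i _.
by rewrite (linfunZ (conj_by_linear U)) conj_by_delta.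
Qed.

Lemma conj_frame_pauli_z n (x y : 'rV[C]_n) :
  conj_by (frame x y) (pauli_z C) = x^t* *m x - y^t* *m y.
Proof.
rewrite (linfunB (conj_by_linear _)) !conj_by_delta.
by rewrite row_frame0 row_frame1.
Qed.

Lemma conj_frame_pauli_x n (x y : 'rV[C]_n) :
  conj_by (frame x y) (pauli_x C) = x^t* *m y + y^t* *m x.
Proof.
rewrite (linfunD (conj_by_linear _)) !conj_by_delta.
by rewrite row_frame0 row_frame1.
Qed.

Lemma conj_frame01 n (x y : 'rV[C]_n) :
  conj_by (frame x y) (delta_mx 0 1) = x^t* *m y.
Proof. by rewrite conj_by_delta row_frame0 row_frame1. Qed.

Lemma std_inv_diag k : is_diag_mx (std_inv C k).
Proof.
elim: k => [|k IHk]; first by apply/is_diag_mxP=> -[].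
rewrite [std_inv _ _]/= blocks_add.
have -> : is_diag_mx (block_mx (pauli_z C) 0 0 (std_inv C k)).
  rewrite is_diag_block_mx // eqxx eqxx IHk andbT /=.
  by apply/is_diag_mxP=> -[[|[|?]] ?] // -[[|[|?]] ?] //; rewrite !mxE /= subrr.
by [].
Qed.

End Frames.

(** * Squares of planes when the target is no larger than the source *)

Section FrameMap.
Variables (C : numClosedFieldType) (k d : nat).
Let m := (2 + k.*2)%N.
Variable f : 'M[C]_(2 + m) -> 'M[C]_d.
Hypothesis fH : inv_map f 1%:M.
Hypothesis d0 : (0 < d)%N.
Hypothesis Sm : min_dim C m.
Hypothesis dm : (d <= m + 2)%N.

(** The square [P(x, y)] attached to the plane with orthonormal basis the rows of [V]. *)
Definition frame_sq (V : 'M[C]_(2, 2 + m)) :=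
  f (conj_by V (pauli_z C)) *m f (conj_by V (pauli_z C)).

Section Split.
Variables (V : 'M[C]_(2, 2 + m)) (W : 'M[C]_(m, 2 + m)).
Hypothesis uU : col_mx V W \is unitarymx.
Let g M := f (conj_by (col_mx V W) M).

Let gH : inv_map g 1%:M. Proof. exact: inv_map_conj. Qed.
Let iY : herm_inv (std_inv C k.+1 : 'M_m). Proof. exact (std_invP C k.+1). Qed.
Let sqE : split_sq g = frame_sq V.
Proof. by rewrite /split_sq /g conj_by_ul. Qed.

Lemma frame_ul : inv_map (fun X => f (conj_by V X)) (frame_sq V).
Proof.
rewrite -sqE; apply: (inv_map_eq _ (split_ul iY gH)) => X.
by rewrite /g conj_by_ul.
Qed.

Lemma frame_dr : inv_map (fun X => f (conj_by W X)) (1%:M - frame_sq V).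
Proof.
rewrite -sqE; apply: (inv_map_eq _ (split_dr gH)) => X.
by rewrite /g conj_by_dr.
Qed.

Lemma frame_sq_herm : (frame_sq V)^t* = frame_sq V.
Proof. by rewrite -sqE split_sq_herm. Qed.

Lemma frame_sq_idem_split : frame_sq V *m frame_sq V = frame_sq V.
Proof.
rewrite -sqE; apply: (split_sq_idem iY gH) => //; clear g gH sqE.
case: (posnP k) => k0; last by left; rewrite /m; lia.
by right; rewrite /m k0; apply: min_dim_strict2.
Qed.

(** Let [P = frame_sq V], an idempotent. For an involution, multiplying
    [h = f (conj_by V Y) (1 - P)] on the left by its adjoint gives [(1 - P) P (1 - P) = 0]. *)
Lemma frame_ul_mulr X : \tr X = 0 ->
  f (conj_by V X) *m frame_sq V = f (conj_by V X).
Proof.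
have [al als aP] := frame_ul.
pose h X := f (conj_by V X) *m (1%:M - frame_sq V).
suff h0 Y : herm_inv Y -> h Y = 0.
  move=> trX; apply/esym/eqP; rewrite -subr_eq0 -{1}(mulmx1 (f _)) -mulmxBr.
  rewrite -/(h X) (pauli_linear_eq0 _ h0 trX) // => a A B.
  by rewrite /h al mulmxDl scalemxAl.
have pp := frame_sq_idem_split; have hp := frame_sq_herm.
move=> iY'; have hY : (f (conj_by V Y))^t* = f (conj_by V Y).
  by rewrite -[LHS]als; case: iY' => ->.
have hq : (1%:M - frame_sq V)^t* = 1%:M - frame_sq V by rewrite trmxCB trmxC1 hp.
apply: trmxC_eq0; apply: mulct_eq0.
rewrite trmxCK /h trmxC_mul hY hq mulmxA -(mulmxA _ _ (f _)) (aP Y iY').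
by rewrite mulmxBl mul1mx pp subrr mul0mx.
Qed.

Lemma frame_dr_mull Y : herm_inv Y -> frame_sq V *m f (conj_by W Y) = 0.
Proof.
move=> iY'; have [_ bs bP] := frame_dr; have pp := frame_sq_idem_split.
apply: mulct_eq0; rewrite trmxC_mul frame_sq_herm -bs.
have [-> _ _] := iY'; rewrite mulmxA -(mulmxA _ _ (f _)) bP //.
by rewrite mulmxBr mulmx1 pp subrr mul0mx.
Qed.

End Split.

Implicit Type V : 'M[C]_(2, 2 + m).

Lemma frame_sq_idem V : V \is unitarymx ->
  frame_sq V *m frame_sq V = frame_sq V.
Proof.
by move=> uV; have [W [_ _ uU]] := unitary_completion uV; apply: frame_sq_idem_split uU.
Qed.

Lemma frame_ul_inv V : V \is unitarymx ->
  inv_map (fun X => f (conj_by V X)) (frame_sq V).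
Proof.
by move=> uV; have [W [_ _ uU]] := unitary_completion uV; apply: frame_ul uU.
Qed.

Lemma frame_herm V X : X^t* = X -> (f (conj_by V X))^t* = f (conj_by V X).
Proof. by move=> hX; case: fH => _ fs _; rewrite -fs -conj_by_ct hX. Qed.

Lemma frame_sq_eq0 V X : V \is unitarymx -> herm_inv X -> frame_sq V = 0 ->
  f (conj_by V X) = 0.
Proof.
move=> uV iX V0; have [_ _ aP] := frame_ul_inv uV.
apply: herm_sq_eq0; first by apply: frame_herm; case: iX.
by rewrite (aP X iX).
Qed.

(* Rotating [x] towards [z] multiplies the idempotent of [(z, y)] by
   [rot_sin ^ 2], which differs from 0 and 1. *)
Lemma frame_null_step x y z : x \is unitarymx -> y \is unitarymx ->
  z \is unitarymx -> x *m y^t* = 0 -> z *m y^t* = 0 -> x *m z^t* = 0 ->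
  frame_sq (frame x y) = 0 -> frame_sq (frame z y) = 0.
Proof.
move=> ux uy uz xy zy xz V0; have [fl _ _] := fH.
have zx : z *m x^t* = 0 by apply: trmxC_eq0; rewrite trmxC_mul trmxCK.
pose w := rot_cos C *: x + rot_sin C *: z.
have uw : w \is unitarymx.
  apply/unitarymxP; rewrite /w trmxCD !trmxCZ rot_cos_real rot_sin_real mulmxDl !mulmxDr.
  rewrite -!scalemxAl -!scalemxAr xz zx !(unitarymxP _) // !scaler0 addr0 add0r.
  by rewrite !scalerA -scalerDl -!expr2 rot_circle scale1r.
have wy : w *m y^t* = 0.
  by rewrite /w mulmxDl -!scalemxAl xy zy !scaler0 addr0.
have uV := frame_unitary ux uy xy; have uVw := frame_unitary uw uy wy.
have uVz := frame_unitary uz uy zy.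
have [_ _ aPw] := frame_ul_inv uVw; have [_ _ aPz] := frame_ul_inv uVz.
have Ew : f (conj_by (frame w y) (pauli_x C)) = rot_sin C *: f (conj_by (frame z y) (pauli_x C)).
  rewrite -[RHS]add0r -{1}(scaler0 _ (rot_cos C)) -(frame_sq_eq0 uV (pauli_x_inv C) V0).
  rewrite -!(linfunZ fl) -(linfunD fl) !conj_frame_pauli_x /w trmxCD !trmxCZ rot_cos_real rot_sin_real.
  by rewrite mulmxDl mulmxDr -!scalemxAl -!scalemxAr !scalerDr addrACA.
have Qw : frame_sq (frame w y) = rot_sin C ^+ 2 *: frame_sq (frame z y).
  rewrite -(aPw _ (pauli_x_inv C)) -(aPz _ (pauli_x_inv C)) Ew -scalemxAl -scalemxAr.
  by rewrite scalerA -expr2.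
have := frame_sq_idem uVw; rewrite Qw -scalemxAl -scalemxAr (frame_sq_idem uVz).
move/eqP; rewrite scalerA -subr_eq0 -scalerBl scaler_eq0.
have s2 : rot_sin C ^+ 2 != 0 by rewrite expf_neq0 // rot_sin_neq0.
rewrite -[X in _ - X]mulr1 -mulrBr mulf_eq0 (negPf s2) /=.
case/orP=> [|/eqP//]; rewrite subr_eq0 => /eqP s1.
have /eqP : rot_cos C ^+ 2 = 0.
  by apply: (addIr (rot_sin C ^+ 2)); rewrite rot_circle add0r s1.
rewrite expf_eq0 /=.
by rewrite (negPf (rot_cos_neq0 C)).
Qed.

(** If one plane of an orthonormal basis had square 0, rotations would spread this until [f] took
    the same value on all projectors of the basis; a traceless diagonal involution would then be
    sent to 0. *)
Lemma frame_sq_neq0 V : V \is unitarymx -> frame_sq V != 0.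
Proof.
move=> uV; apply/eqP=> V0; have [fl _ fP] := fH.
have [W [_ _ uU]] := unitary_completion uV; set U := col_mx V W in uU.
pose i0 : 'I_(2 + m) := lshift m (0 : 'I_2); pose i1 : 'I_(2 + m) := lshift m (1 : 'I_2).
have r0 : row i0 U = row 0 V by rewrite rowKu.
have r1 : row i1 U = row 1 V by rewrite rowKu.
have ur i : row i U \is unitarymx by apply/unitarymxP; rewrite unitary_rowP ?eqxx.
have orth i j : i != j -> row i U *m (row j U)^t* = 0.
  by move=> /negPf ij; rewrite unitary_rowP // ij raddf0.
have V0' : frame_sq (frame (row i0 U) (row i1 U)) = 0.
  by rewrite r0 r1 -frame_rows.
have i01 : i0 != i1 by [].
have Z i : f ((row i U)^t* *m row i U) = f ((row i1 U)^t* *m row i1 U).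
  apply/eqP; rewrite -subr_eq0 -(linfunB fl); apply/eqP.
  have [->|ii1] := eqVneq i i1; first by rewrite subrr (linfun0 fl).
  rewrite -conj_frame_pauli_z; apply: frame_sq_eq0 (pauli_z_inv C) _.
    by apply: frame_unitary; rewrite ?ur ?orth.
  have [->//|ii0] := eqVneq i i0.
  by apply: frame_null_step V0'; rewrite ?ur ?orth // eq_sym.
have iS : herm_inv (std_inv C k.+2 : 'M_(2 + m)) by exact (std_invP C k.+2).
have [e Se] : exists e, (std_inv C k.+2 : 'M_(2 + m)) = diag_mx e.
  by apply/diag_mxP; exact (std_inv_diag C k.+2).
have := fP _ (herm_inv_conj uU iS); rewrite Se conj_by_diag (linfun_sum fl).
under eq_bigr => i _ do rewrite (linfunZ fl) Z.
rewrite -scaler_suml; have [_ + _] := iS; rewrite Se mxtrace_diag => ->.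
rewrite scale0r mul0mx => /matrixP/(_ (Ordinal d0) (Ordinal d0)).
by rewrite !mxE eqxx => /esym/eqP; rewrite oner_eq0.
Qed.

(** [frame_dr_mull] applies to involutions on the whole complement of [V]. Adding [std_inv] on [W]
    with either sign and combining the two cases isolates the part on [W0]. *)
Lemma frame_dr_mull_ul V (W0 : 'M[C]_(2, 2 + m)) (W : 'M[C]_(k.*2, 2 + m)) X :
  col_mx V (col_mx W0 W : 'M_(m, 2 + m)) \is unitarymx -> \tr X = 0 ->
  frame_sq V *m f (conj_by W0 X) = 0.
Proof.
move=> uU; have [fl _ _] := fH.
apply: (@pauli_linear_eq0 C _ (fun X => frame_sq V *m f (conj_by W0 X))) => [a A B|A iA].
  by rewrite conj_by_linear fl mulmxDr -scalemxAr.
have iS := std_invP C k.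
have := frame_dr_mull uU (herm_inv_block iA iS).
have := frame_dr_mull uU (herm_inv_block iA (herm_invN iS)).
rewrite (linfunN (@drblock_linear C 2 k.*2)) -/(_ - _).
rewrite (linfunB (conj_by_linear _)) (linfunD (conj_by_linear _)) conj_by_ul conj_by_dr.
rewrite (linfunB fl) (linfunD fl) mulmxBr mulmxDr => /eqP; rewrite subr_eq0 => /eqP <- /eqP.
by rewrite -mulr2n -scaler_nat scaler_eq0 pnatr_eq0 => /eqP.
Qed.

(** The eigenvalue 1 occurs because the idempotent is nonzero, with an eigenspace of dimension at
    least 2; the eigenvalue 0 occurs as well, with one of dimension at least [m]. *)
Lemma frame_rank V : V \is unitarymx ->
  (2 <= \rank (frame_sq V))%N /\ (\rank (frame_sq V) + m <= d)%N.
Proof.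
move=> uV; have [W [uW _ uU]] := unitary_completion uV.
have pp := frame_sq_idem uV; have [fl _ _] := fH.
have iY : herm_inv (std_inv C k.+1 : 'M_m) by exact (std_invP C k.+1).
pose g M := f (conj_by (col_mx V W) M).
have gH : inv_map g 1%:M by apply: inv_map_conj.
have sqE : split_sq g = frame_sq V by rewrite /split_sq /g conj_by_ul.
split.
  have : eigenvalue (frame_sq V) 1.
    have [i Pi] : exists i, row i (frame_sq V) != 0.
      apply/existsP; apply: contraNT (frame_sq_neq0 uV); rewrite negb_exists.
      move/forallP=> P0; apply/eqP/row_matrixP=> i.
      by have := P0 i; rewrite negbK row0 => /eqP.
    by apply/eigenvalueP; exists (row i (frame_sq V)); rewrite // -row_mul pp scale1r.
  rewrite -sqE => e1; apply: leq_trans (split_eigen_ul iY gH e1 (oner_neq0 C)) _.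
  apply: mxrankS; have /eigenspaceP := submx_refl (eigenspace (split_sq g) 1).
  by rewrite scale1r => <-; apply: submxMl.
have rP : \rank (eigenspace (frame_sq V) 0) = (d - \rank (frame_sq V))%N.
  by rewrite /eigenspace raddf0 subr0 mxrank_ker.
(* Without the eigenvalue 0 the idempotent would be 1, and [frame_dr_mull_ul] would make [f] vanish
   on a plane orthogonal to [V], against [frame_sq_neq0]. *)
have e0 : eigenvalue (frame_sq V) 0.
  rewrite /eigenvalue -mxrank_eq0 rP subn_eq0 -ltnNge ltn_neqAle rank_leq_row andbT.
  apply/eqP=> fullP; have uP : frame_sq V \in unitmx by rewrite -row_free_unit -row_leq_rank fullP.
  have P1 : frame_sq V = 1%:M by rewrite -[LHS](mulKmx uP) pp mulVmx.
  pose W0 := usubmx (W : 'M_(2 + k.*2, 2 + m)).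
  have uU' : col_mx V (col_mx W0 (dsubmx (W : 'M_(2 + k.*2, 2 + m))) : 'M_(m, 2 + m)) \is unitarymx.
    by rewrite vsubmxK.
  have tz : \tr (pauli_z C) = 0 by case: (pauli_z_inv C).
  have := frame_dr_mull_ul uU' tz; rewrite P1 mul1mx => W00.
  have uW0 : W0 \is unitarymx by apply: usubmx_unitary.
  by have := frame_sq_neq0 uW0; rewrite /frame_sq W00 mul0mx eqxx.
have := split_eigen_dr iY gH Sm; rewrite sqE => /(_ _ e0).
rewrite eq_sym oner_neq0 rP => /(_ erefl); have := rank_leq_row (frame_sq V); lia.
Qed.

(** [frame_sq V] can be inserted between the factors: it is absorbed by the first and annihilates
    the second. *)
Lemma frame_zero_product V (W0 : 'M[C]_(2, 2 + m)) X Y : V \is unitarymx ->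
  W0 \is unitarymx -> V *m W0^t* = 0 -> \tr X = 0 -> \tr Y = 0 ->
  f (conj_by V X) *m f (conj_by W0 Y) = 0.
Proof.
move=> uV uW0 VW0 trX trY; have uV4 := col_mx_unitary uV uW0 VW0.
have [W [uW V4W _]] := @unitary_completion C (2 + 2) k.*2 _ uV4.
move: V4W; rewrite mul_col_mx => /eqP; rewrite col_mx_eq0 => /andP[/eqP VW /eqP W0W].
have uW' := col_mx_unitary uW0 uW W0W.
have VW' : V *m (col_mx W0 W)^t* = 0.
  by rewrite tr_col_mx map_row_mx mul_mx_row VW0 VW row_mx0.
have uU := col_mx_unitary uV uW' VW'.
rewrite -(frame_ul_mulr uU trX) -mulmxA.
by rewrite (frame_dr_mull_ul uU trY) mulmx0.
Qed.

End FrameMap.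

(** A target smaller than the source meets the size condition of [frame_rank], whose two bounds add
    up to the full source dimension. *)
Lemma min_dim_double (C : numClosedFieldType) k : min_dim C k.+1.*2.
Proof.
elim: k => [|k IHk]; first exact: min_dim2.
move=> d f fH d0; rewrite leqNgt; apply/negP=> dk.
have dm : (d <= 2 + k.*2 + 2)%N by rewrite doubleS in dk *; lia.
have uV : usubmx (1%:M : 'M[C]_(2 + (2 + k.*2))) \is unitarymx.
  by apply: usubmx_unitary; apply/unitarymxP; rewrite trmxC1 mulmx1.
have [r2 rm] := frame_rank fH d0 IHk dm uV.
by move: dk r2 rm; rewrite !doubleS; lia.
Qed.

Section Trace.
Variables (C : numClosedFieldType) (k : nat).
Variable f : 'M[C]_(2 + (2 + k.*2)) -> 'M[C]_(2 + (2 + k.*2)).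
Hypothesis fH : inv_map f 1%:M.

(** With source and target of equal size the two bounds of [frame_rank] meet, so the rank is exactly
    2. *)
Lemma frame_trace V : V \is unitarymx -> \tr (frame_sq f V) = 2.
Proof.
move=> uV; have dm : (2 + (2 + k.*2) <= 2 + k.*2 + 2)%N by lia.
have [r2 rm] := frame_rank fH isT (@min_dim_double C k) dm uV.
rewrite idem_trace; last exact: frame_sq_idem fH isT (@min_dim_double C k) dm _ uV.
by congr _%:R; move: r2 rm; lia.
Qed.
End Trace.

(** * Diagonal matrices *)

Lemma exists_fresh n (s : seq 'I_n) : (size s < n)%N -> exists i, i \notin s.
Proof.
move=> sn; apply/existsP; rewrite -negb_forall; apply/negP=> /forallP sT.
have := leq_ltn_trans (uniq_leq_size (enum_uniq 'I_n) (fun i _ => sT i)) sn.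
by rewrite size_enum_ord ltnn.
Qed.

Ltac neqs := rewrite /= ?(inE, negb_or); repeat (apply/andP; split);
  (done || (rewrite eq_sym; done)).

Section Diagonal.
Variables (C : numClosedFieldType) (n : nat) (h : 'I_n -> 'I_n -> 'M[C]_n).
Hypothesis n4 : (3 < n)%N.
Hypothesis hD : forall i j l, h i j + h j l = h i l.
Hypothesis hH : forall i j, (h i j)^t* = h i j.
Hypothesis hZ : forall i j k l, uniq [:: i; j; k; l] -> h i j *m h k l = 0.
Hypothesis hI : forall i j, i != j ->
  h i j *m h i j *m (h i j *m h i j) = h i j *m h i j.
Hypothesis hT : forall i j, i != j -> \tr (h i j *m h i j) = 2.
Hypothesis hT0 : forall i j, \tr (h i j) = 0.

Let hii i : h i i = 0.
Proof. by apply: (addIr (h i i)); rewrite hD add0r. Qed.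

Let hN i j : h j i = - h i j.
Proof. by apply/eqP; rewrite -addr_eq0 hD hii. Qed.

Let fresh3 (i j k : 'I_n) : exists l, l \notin [:: i; j; k].
Proof. exact: exists_fresh. Qed.

(** The difference of the two sides is [h i j] times [h l k], a product over disjoint pairs of
    indices. *)
Let hR i j k l : uniq [:: i; j; k; l] -> h i j *m h i k = h i j *m h i l.
Proof.
rewrite /= !inE !negb_or -!andbA => /and5P[ij ik il jk /and3P[jl kl _]].
apply/eqP; rewrite -subr_eq0 -mulmxBr -hN addrC hD hZ //; neqs.
Qed.

Let hL i j k l : uniq [:: i; j; k; l] -> h i k *m h i j = h i l *m h i j.
Proof.
rewrite /= !inE !negb_or -!andbA => /and5P[ij ik il jk /and3P[jl kl _]].
apply/eqP; rewrite -subr_eq0 -mulmxBl -hN addrC hD hZ //; neqs.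
Qed.

(** Through a fourth index: [h i j h i k = h i j h i l = h i k h i l = h i k h i j]. *)
Let hC i j k : uniq [:: i; j; k] -> h i j *m h i k = h i k *m h i j.
Proof.
rewrite /= !inE !negb_or -!andbA => /and4P[ij ik jk _].
have [l] := fresh3 i j k; rewrite !inE !negb_or => /and3P[li lj lk].
rewrite (hR (l := l)); last by neqs.
rewrite (hL (l := k)); last by neqs.
by rewrite (hR (l := j)) //; neqs.
Qed.

(** The auxiliary indices are changed one at a time, after a swap by [hC] when [k] is already the
    reference index [a]. *)
Let diag_proj : exists F : 'I_n -> 'M[C]_n,
  forall i j k, uniq [:: i; j; k] -> F i = h i j *m h i k.
Proof.
suff : forall i, exists Fi, forall j k, uniq [:: i; j; k] -> Fi = h i j *m h i k.
  by case/fin_all_exists => F FE; exists F.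
move=> i; have [a] := fresh3 i i i; rewrite !inE !negb_or => /and3P[ai _ _].
have [b] := fresh3 i a a; rewrite !inE !negb_or => /and3P[bi ba _].
exists (h i a *m h i b) => j k; rewrite /= !inE !negb_or -!andbA => /and4P[ij ik jk _].
have toK c d d' : uniq [:: i; c; d] -> uniq [:: i; c; d'] ->
    h i c *m h i d = h i c *m h i d'.
  rewrite /= !inE !negb_or -!andbA => /and4P[ic id cd _] /and4P[_ id' cd' _].
  have [->//|dd'] := eqVneq d d'.
  by apply: hR; neqs.
have toJ c d d' : uniq [:: i; c; d] -> uniq [:: i; c; d'] ->
    h i d *m h i c = h i d' *m h i c.
  move=> u u'; rewrite -(hC u) -(hC u'); exact: toK.
have [ka|ka] := eqVneq k a.
  by rewrite {}ka in ik jk *; rewrite (@hC i j a); [apply: toK; neqs | neqs].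
by rewrite (toK _ _ k); [apply: toJ; neqs | neqs | neqs].
Qed.

Lemma diagonal_form : exists U c, [/\ U \is unitarymx, c = 1 \/ c = -1 &
  forall i j, h i j = c *: conj_by U (delta_mx i i - delta_mx j j)].
Proof.
have [F FE] := diag_proj.
have fresh (i j : 'I_n) : i != j -> exists k l, [/\ i != k, j != k, i != l, j != l & k != l].
  move=> _; have [k] := fresh3 i j j; rewrite !inE !negb_or => /and3P[ki kj _].
  have [l] := fresh3 i j k; rewrite !inE !negb_or => /and3P[li lj lk].
  by exists k, l; split; neqs.
(* The auxiliary indices make the two inner factors [h i k] and [h j l], whose product is 0. *)
have FF0 i j : i != j -> F i *m F j = 0.
  move=> ij; have [k [l [ik jk il jl kl]]] := fresh _ _ ij.
  rewrite (FE i j k); last by neqs.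
  rewrite (FE j l k); last by neqs.
  by rewrite mulmxA -(mulmxA (h i j)) hZ ?mulmx0 ?mul0mx //; neqs.
have sqE i j : i != j -> h i j *m h i j = F i + F j.
  move=> ij; have [k [l [ik jk il jl kl]]] := fresh _ _ ij.
  rewrite -{2}(hD i k j) mulmxDr (FE i j k); last by neqs.
  rewrite (FE j i k); last by neqs.
  by rewrite (hN i j) (hN k j) mulNmx mulmxN opprK.
have third (i : 'I_n) : exists j k, [/\ i != j, i != k & j != k].
  have [j] := fresh3 i i i; rewrite !inE !negb_or => /and3P[ji _ _].
  have ij : i != j by rewrite eq_sym.
  by have [k [l [ik jk _ _ _]]] := fresh _ _ ij; exists j, k.
(* Over three indices, vanishing pairwise sums force [D = 0] in the absence of 2-torsion. This
   yields first that [F i] is idempotent, then that its trace is 1. *)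
have half (V : zmodType) (D : 'I_n -> V) : (forall x : V, x + x = 0 -> x = 0) ->
    (forall i j, i != j -> D i + D j = 0) -> forall i, D i = 0.
  move=> V2 DD i; have [j [k [ij ik jk]]] := third i.
  have Dj : D j = - D i by apply/eqP; rewrite -addr_eq0 addrC DD.
  have Dk : D k = - D i by apply/eqP; rewrite -addr_eq0 addrC DD.
  by have := DD _ _ jk; rewrite Dj Dk => /V2/eqP; rewrite oppr_eq0 => /eqP.
have Fid i : F i *m F i = F i.
  pose D i := F i *m F i - F i.
  suff D0 : forall i : 'I_n, D i = 0 by apply/eqP; rewrite -subr_eq0 -/(D i) D0.
  apply: (half _ D) => [x /eqP|{}i j ij].
    by rewrite -mulr2n -scaler_nat scaler_eq0 pnatr_eq0 => /eqP.
  have := hI ij.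
  rewrite sqE // mulmxDl !mulmxDr (FF0 i j) // (FF0 j i) 1?eq_sym // addr0 add0r => E.
  by rewrite /D addrACA -opprD E subrr.
have Ftr i : \tr (F i) = 1.
  pose D i := \tr (F i) - 1.
  suff D0 : forall i : 'I_n, D i = 0 by apply/eqP; rewrite -subr_eq0 -/(D i) D0.
  apply: (half _ D) => [x /eqP|{}i j ij].
    by rewrite -mulr2n mulrn_eq0 => /eqP.
  by rewrite /D addrACA -opprD -raddfD /= -sqE // hT // subrr.
have FH i : (F i)^t* = F i.
  have [j [k [ij ik jk]]] := third i.
  rewrite (FE i j k); last by neqs.
  by rewrite trmxC_mul !hH hC //; neqs.
have /fin_all_exists[v vP] : forall i, exists vi : 'cV[C]_n,
    F i = vi *m vi^t* /\ vi^t* *m vi = 1%:M.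
  move=> i; have [vi Fv vv] := projection_rank1 (FH i) (Fid i) (Ftr i).
  by exists vi.
have vv0 i j : i != j -> (v i)^t* *m v j = 0.
  move=> ij; have := FF0 _ _ ij; rewrite (vP i).1 (vP j).1.
  move/(congr1 (fun M => (v i)^t* *m M *m v j)).
  rewrite !mulmxA (vP i).2 mul1mx -(mulmxA _ _ (v j)) (vP j).2 mulmx1.
  by rewrite mulmx0 mul0mx.
pose U : 'M[C]_n := \matrix_i (v i)^t*.
have rU i : row i U = (v i)^t* by rewrite rowK.
have uU : U \is unitarymx.
  apply/row_unitarymxP=> i j; rewrite dotmxE !rU trmxCK.
  have [->|ij] := eqVneq i j; first by rewrite (vP j).2 !mxE.
  by rewrite vv0 // mxE.
have FU i : conj_by U (delta_mx i i) = F i by rewrite conj_by_delta rU trmxCK (vP i).1.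
have hFC i j : i != j -> h i j *m F i = F i *m h i j.
  move=> ij; have [k [l [ik jk il jl kl]]] := fresh _ _ ij.
  rewrite [in LHS](FE i k j); last by neqs.
  rewrite [in RHS](FE i j k); last by neqs.
  by rewrite mulmxA.
pose s i j := ((v i)^t* *m h i j *m v i) 0 0.
have hF i j : i != j -> h i j *m F i = s i j *: F i.
  move=> ij; rewrite -(Fid i) mulmxA hFC // (vP i).1.
  have -> : v i *m (v i)^t* *m h i j *m (v i *m (v i)^t* ) =
    v i *m ((v i)^t* *m h i j *m v i) *m (v i)^t* by rewrite !mulmxA.
  rewrite [_ *m v i in X in X *m _]mx11_scalar mul_mx_scalar -scalemxAl.
  by rewrite -/(s i j) mulmxA -(mulmxA (v i)) (vP i).2 mulmx1.
have Fn0 (i : 'I_n) : F i != 0.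
  by apply/eqP=> F0; have := Ftr i; rewrite F0 mxtrace0 => /esym/eqP; rewrite oner_eq0.
have scF i a b : a *: F i = b *: F i -> a = b.
  by move/eqP; rewrite -subr_eq0 -scalerBl scaler_eq0 (negPf (Fn0 i)) orbF subr_eq0 => /eqP.
have sjk i j k : i != j -> i != k -> s i j = s i k.
  move=> ij ik; apply: (scF i); rewrite -!hF //.
  have [->//|jk] := eqVneq j k.
  have [l] := fresh3 i j k; rewrite !inE !negb_or => /and3P[li lj lk].
  apply/eqP; rewrite -subr_eq0 -mulmxBl -hN addrC hD (FE i l j); last by neqs.
  by rewrite mulmxA hZ ?mul0mx //; neqs.
have hE i j : i != j -> h i j = s i j *: F i - s j i *: F j.
  move=> ij; have ji : j != i by rewrite eq_sym.
  have pE := sqE _ _ ij; have pp := hI ij.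
  (* [h = h^3]: as [h] is hermitian with [h^4 = h^2], the product of [h - h^3] with its adjoint is
     [h^2 - 2 h^4 + h^6 = 0]. *)
  have -> : h i j = h i j *m (h i j *m h i j).
    apply/eqP; rewrite -subr_eq0; apply/eqP; apply: mulct_eq0.
    rewrite trmxCB !trmxC_mul !hH mulmxBl !mulmxBr -!mulmxA; rewrite -!mulmxA in pp.
    by rewrite !pp subrr.
  by rewrite pE mulmxDr hF // -[h i j]opprK -hN mulNmx hF.
have sij i j : i != j -> s i j = s j i.
  move=> ij; have := hT0 i j; rewrite hE // raddfB /= !mxtraceZ !Ftr !mulr1.
  by move/eqP; rewrite subr_eq0 => /eqP.
have s2 i j : i != j -> s i j = 1 \/ s i j = -1.
  move=> ij; have : s i j ^+ 2 = 1.
    apply: (scF i); rewrite scale1r expr2 -scalerA -hF // scalemxAr -hF //.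
    by rewrite mulmxA sqE // mulmxDl Fid FF0 1?eq_sym // addr0.
  by move/eqP; rewrite sqrf_eq1 => /orP[]/eqP; [left|right].
pose i0 : 'I_n := Ordinal (leq_trans (isT : 0 < 4)%N n4).
have [i1 [_ [i01 _ _]]] := third i0.
(* Signs agree along a row by [sjk] and across the diagonal by [sij], so a single sign remains. *)
have sc i j : i != j -> s i j = s i0 i1.
  move=> ij; have [ii0|ii0] := eqVneq i i0; first by rewrite ii0 (sjk _ _ i1) // -ii0.
  by rewrite (sjk _ _ i0) // sij // (sjk _ _ i1) // eq_sym.
exists U, (s i0 i1); split=> //; first exact: s2.
move=> i j; have [->|ij] := eqVneq i j.
  by rewrite hii subrr (linfun0 (conj_by_linear U)) scaler0.
rewrite (linfunB (conj_by_linear U)) !FU scalerBr hE // !sc //.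
by rewrite eq_sym.
Qed.

End Diagonal.

(** * Off-diagonal matrix units *)

Section Sl2.
Variables (C : numClosedFieldType) (d : nat) (a : 'M[C]_2 -> 'M[C]_d) (P : 'M[C]_d).
Hypothesis aH : inv_map a P.

Let al : linear a. Proof. by case: aH. Qed.
Let aP A : herm_inv A -> a A *m a A = P. Proof. by case: aH => _ _; apply. Qed.
Let xy := inv_map_anticomm aH (pauli_x_inv C) (pauli_y_inv C) (pauli_xy C).

Let delta01 : delta_mx 0 1 = 2^-1 *: (pauli_x C + 'i *: pauli_y C).
Proof.
rewrite /pauli_y scalerA -expr2 sqrCi scaleN1r opprB /pauli_x addrACA subrr addr0.
by rewrite -mulr2n -scaler_nat scalerA mulVf ?scale1r // pnatr_eq0.
Qed.

Let delta10 : delta_mx 1 0 = 2^-1 *: (pauli_x C - 'i *: pauli_y C).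
Proof.
rewrite /pauli_y scalerA -expr2 sqrCi scaleN1r opprK addrC /pauli_x addrA subrK.
by rewrite -mulr2n -scaler_nat scalerA mulVf ?scale1r // pnatr_eq0.
Qed.

(** In [delta_mx 0 1 = (pauli_x + 'i pauli_y) / 2] the images of the two terms anticommute, and
    their squares cancel because ['i] squares to -1. *)
Lemma inv_map_nilpotent : a (delta_mx 0 1) *m a (delta_mx 0 1) = 0.
Proof.
rewrite delta01 !(linfunZ al) (linfunD al) (linfunZ al _ (pauli_y C)) -scalemxAl -scalemxAr.
have := mulmx_lincomb (a (pauli_x C)) (a (pauli_y C)) 1 'i; rewrite scale1r => ->.
rewrite (aP (pauli_x_inv C)) (aP (pauli_y_inv C)) xy addNr scaler0 addr0 expr1n sqrCi.
by rewrite scale1r scaleN1r subrr !scaler0.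
Qed.

Lemma inv_map_ladder : a (delta_mx 0 1) *m a (delta_mx 1 0)
  + a (delta_mx 1 0) *m a (delta_mx 0 1) = P.
Proof.
have ix := pauli_x_inv C; have iy := pauli_y_inv C.
rewrite delta01 delta10 !(linfunZ al) (linfunB al) (linfunD al) (linfunZ al _ (pauli_y C)).
rewrite -!scalemxAl -!scalemxAr -!scalerDr scalerA.
rewrite !mulmxDl !mulmxDr !mulmxN !mulNmx -!scalemxAl -!scalemxAr.
rewrite !scalerA (aP ix) (aP iy) mulCii.
move: (a (pauli_x C) *m a (pauli_y C)) (a (pauli_y C) *m a (pauli_x C)) => A B.
by apply/matrixP=> i j; rewrite !mxE; field.
Qed.

Lemma inv_map_pauli_z_anticomm :
  a (pauli_z C) *m a (delta_mx 0 1) = - (a (delta_mx 0 1) *m a (pauli_z C)).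
Proof.
have iz := pauli_z_inv C; have ix := pauli_x_inv C; have iy := pauli_y_inv C.
rewrite delta01 !(linfunZ al) (linfunD al (pauli_x C)) (linfunZ al _ (pauli_y C)) -scalemxAl -!scalemxAr.
rewrite mulmxDr mulmxDl -scalemxAl -scalemxAr.
rewrite (inv_map_anticomm aH iz ix (pauli_zx C)) (inv_map_anticomm aH iz iy (pauli_zy C)).
by rewrite scalerN -opprD scalerN.
Qed.

End Sl2.

Section Units.
Variables (C : numClosedFieldType) (n : nat).

Definition erow (i : 'I_n) : 'rV[C]_n := delta_mx 0 i.

Lemma erow_ctM i j : (erow i)^t* *m erow j = delta_mx i j.
Proof. by rewrite trmxC_delta mul_delta_mx. Qed.

Lemma erowM_ct i j : erow i *m (erow j)^t* = (i == j)%:R%:M.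
Proof.
rewrite trmxC_delta mul_delta_mx_cond; apply/matrixP=> a b.
by rewrite !mxE (ord1 a) (ord1 b) eqxx; case: (i == j); rewrite ?mxE.
Qed.

Lemma erow_unitary i : erow i \is unitarymx.
Proof. by apply/unitarymxP; rewrite erowM_ct eqxx. Qed.

Lemma eframe_unitary i j : i != j -> frame (erow i) (erow j) \is unitarymx.
Proof.
move=> /negPf ij; apply: frame_unitary; rewrite ?erow_unitary //.
by rewrite erowM_ct ij raddf0.
Qed.

Lemma eframe01 i j : conj_by (frame (erow i) (erow j)) (delta_mx 0 1) = delta_mx i j.
Proof. by rewrite conj_frame01 erow_ctM. Qed.

Lemma eframe10 i j : conj_by (frame (erow i) (erow j)) (delta_mx 1 0) = delta_mx j i.
Proof. by rewrite conj_by_delta row_frame0 row_frame1 erow_ctM. Qed.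

Lemma eframe_pauli_z i j :
  conj_by (frame (erow i) (erow j)) (pauli_z C) = delta_mx i i - delta_mx j j.
Proof. by rewrite conj_frame_pauli_z !erow_ctM. Qed.

Lemma mul_delta_entry m (A : 'M[C]_(n, m)) i j p q :
  (delta_mx i j *m A : 'M_(n, m)) p q = (i == p)%:R * A j q.
Proof.
rewrite mxE (bigD1 j) //= big1 => [|l lj]; first by rewrite mxE eqxx andbT addr0 eq_sym.
by rewrite mxE (negPf lj) andbF mul0r.
Qed.

Lemma sub_entry m (A B : 'M[C]_(n, m)) p q : (A - B) p q = A p q - B p q.
Proof. by rewrite !mxE. Qed.

Lemma add_entry m (A B : 'M[C]_(n, m)) p q : (A + B) p q = A p q + B p q.
Proof. by rewrite mxE. Qed.

Lemma scale_entry m c (A : 'M[C]_(n, m)) p q : (c *: A) p q = c * A p q.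
Proof. by rewrite mxE. Qed.

Lemma mul_entry_delta m (A : 'M[C]_(m, n)) i j p q :
  (A *m delta_mx i j : 'M_(m, n)) p q = A p i * (j == q)%:R.
Proof.
rewrite mxE (bigD1 i) //= big1 => [|l lj]; first by rewrite mxE eqxx addr0 eq_sym.
by rewrite mxE (negPf lj) mulr0.
Qed.

(** By hypothesis [h] takes one value on all diagonal units and kills the others, so [h M] is the
    trace times that value. *)
Lemma traceless_linear_eq0 (V : lmodType C) (h : 'M[C]_n -> V) (o : 'I_n) M :
  linear h -> (forall i j, i != j -> h (delta_mx i j) = 0) ->
  (forall i, h (delta_mx i i - delta_mx o o) = 0) -> \tr M = 0 -> h M = 0.
Proof.
move=> hl h0 hd trM; rewrite (matrix_sum_delta M) (linfun_sum hl).
under eq_bigr => i _.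
  rewrite (linfun_sum hl) (bigD1 i) //= big1 => [|j ji]; last first.
    by rewrite (linfunZ hl) h0 ?scaler0 // eq_sym.
  rewrite addr0 (linfunZ hl) -[delta_mx i i](subrK (delta_mx o o)) (linfunD hl) hd add0r.
over.
by rewrite -scaler_suml -/(\tr M) trM scale0r.
Qed.

(* [a] is a unimodular cocycle, hence a coboundary. *)
Lemma monomial_form (f : 'M[C]_n -> 'M[C]_n) (a : 'I_n -> 'I_n -> C) (o : 'I_n) :
  linear f -> (forall i j, f (delta_mx i i - delta_mx j j) = delta_mx i i - delta_mx j j) ->
  (forall i j, i != j -> f (delta_mx i j) = a i j *: delta_mx i j) ->
  (forall i j, i != j -> a j i = (a i j)^* ) ->
  (forall i j, i != j -> a i j * (a i j)^* = 1) ->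
  (forall i j l, uniq [:: i; j; l] -> a i l = a i j * a j l) ->
  exists2 W, W \is unitarymx &
    forall M, \tr M = 0 -> f M = W *m M *m W^t*.
Proof.
move=> fl fd fo aH a1 aM.
(* Normalised by [w o = 1]; the cocycle relation through [o] then writes [a i j] as [w i] times the
   conjugate of [w j]. *)
pose w i := if i == o then 1 else a i o; pose W : 'M[C]_n := diag_mx (\row_i w i).
have ww i : w i * (w i)^* = 1.
  by rewrite /w; case: eqP => [_|/eqP io]; rewrite ?conjC1 ?mulr1 ?a1.
have WH : W^t* = diag_mx (\row_i (w i)^* ).
  rewrite /W tr_diag_mx; apply/matrixP=> i j; rewrite !mxE.
  by case: eqP; rewrite ?mulr1n ?mulr0n ?conjC0.
have wa i j : i != j -> a i j = w i * (w j)^*.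
  move=> ij; rewrite /w; have [io|io] := eqVneq i o; have [jo|jo] := eqVneq j o.
  - by move: ij; rewrite io jo eqxx.
  - by rewrite mul1r io -aH.
  - by rewrite jo conjC1 mulr1.
  - by rewrite (aM i j o) -?mulrA ?a1 ?mulr1 //; neqs.
have Wd i j : W *m delta_mx i j *m W^t* = (w i * (w j)^* ) *: delta_mx i j.
  rewrite WH; apply/matrixP=> p q; rewrite /W mul_diag_mx mul_mx_diag !mxE.
  by case: eqP => [->|_]; case: eqP => [->|_]; rewrite ?mulr1 ?mulr0 ?mul0r // mulrAC.
exists W.
  apply/unitarymxP; rewrite WH mulmx_diag; apply/matrixP=> i j.
  by rewrite !mxE ww.
move=> M trM; apply/eqP; rewrite -subr_eq0; apply/eqP.
apply: (@traceless_linear_eq0 _ (fun M => f M - W *m M *m W^t* ) o) => //.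
- move=> c X Y; rewrite fl mulmxDr mulmxDl -scalemxAr -scalemxAl scalerBr.
  by rewrite opprD addrACA.
- by move=> i j ij; rewrite fo // Wd wa // subrr.
- by move=> i; rewrite fd mulmxBr mulmxBl !Wd !ww !scale1r subrr.
Qed.

End Units.

Definition inv_preserver (C : numClosedFieldType) n (f : 'M[C]_n -> 'M[C]_n) :=
  inv_map f 1%:M /\ (forall M, \tr M = 0 -> \tr (f M) = 0).

Lemma herm_inv_tr (C : numClosedFieldType) n (A : 'M[C]_n) :
  herm_inv A -> herm_inv A^T.
Proof.
move=> [hA tA AA]; split; last by rewrite -trmx_mul AA trmx1.
  by rewrite -[in RHS]hA; apply/matrixP=> i j; rewrite !mxE.
by rewrite mxtrace_tr.
Qed.

(** Composing with transposition exchanges the roles of [a] and [b], which reduces the transposed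
    case to the other one. *)
Lemma inv_preserver_tr (C : numClosedFieldType) n (f : 'M[C]_n -> 'M[C]_n) :
  inv_preserver f -> inv_preserver (fun M => f M^T).
Proof.
move=> [[fl fs fP] ft]; split; last by move=> M trM; rewrite ft // mxtrace_tr.
split=> [a X Y|M|A iA]; first by rewrite linearD linearZ fl.
  by rewrite -fs; congr f; apply/matrixP=> i j; rewrite !mxE.
by apply: fP; apply: herm_inv_tr.
Qed.

(** * Diagonal differences and zero products in even size at least 4 *)

Section Preserver.
Variables (C : numClosedFieldType) (k : nat).
Let n := (2 + (2 + k.*2))%N.
Variable f : 'M[C]_n -> 'M[C]_n.
Hypothesis fp : inv_preserver f.

Let fH : inv_map f 1%:M. Proof. by case: fp. Qed.
Let fl : linear f. Proof. by case: fH. Qed.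
Let fs M : f (M^t* ) = (f M)^t*. Proof. by case: fH. Qed.
Let dm : (n <= 2 + k.*2 + 2)%N. Proof. by rewrite /n; lia. Qed.
Let n0 : (0 < n)%N. Proof. by []. Qed.
Let Sm : min_dim C (2 + k.*2) := @min_dim_double C k.
Let fresh3 (i j l : 'I_n) : exists q, q \notin [:: i; j; l].
Proof. exact: exists_fresh. Qed.

Lemma hdiff_zero i j p q : uniq [:: i; j; p; q] ->
  f (delta_mx i i - delta_mx j j) *m f (delta_mx p p - delta_mx q q) = 0.
Proof.
rewrite /= !inE !negb_or -!andbA => /and5P[ij ip iq jp /and3P[jq pq _]].
have tz : \tr (pauli_z C) = 0 by case: (pauli_z_inv C).
rewrite -!eframe_pauli_z (frame_zero_product fH n0 Sm dm) ?eframe_unitary //.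
by apply: frame_orth; rewrite erowM_ct ?(negPf ip) ?(negPf iq) ?(negPf jp)
  ?(negPf jq) raddf0.
Qed.

(** Extends [frame_zero_product] by scaling to vectors of any length, so that it can be tested on
    simple combinations of basis vectors. *)
Lemma zero_product (x y z t : 'rV[C]_n) : x *m y^t* = 0 -> z *m t^t* = 0 ->
  x *m z^t* = 0 -> x *m t^t* = 0 -> y *m z^t* = 0 -> y *m t^t* = 0 ->
  f (x^t* *m y) *m f (z^t* *m t) = 0.
Proof.
have normal (u : 'rV[C]_n) : exists c v, u = c *: v /\ (v \is unitarymx \/ c = 0).
  have [->|u0] := eqVneq u 0; first by exists 0, 0; rewrite scale0r; split=> //; right.
  pose r := (u *m u^t* ) 0 0.
  have r0 : 0 < r by rewrite /r -dotmxE dnorm_gt0.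
  have sr0 : sqrtC r != 0 by rewrite sqrtC_eq0 gt_eqF.
  exists (sqrtC r), ((sqrtC r)^-1 *: u); split.
    by rewrite scalerA mulfV // scale1r.
  left; apply/unitarymxP; rewrite trmxCZ -scalemxAl -scalemxAr scalerA.
  have -> : ((sqrtC r)^-1)^* = (sqrtC r)^-1.
    by apply/CrealP; rewrite realV ger0_real // sqrtC_ge0 ltW.
  rewrite -invfM -expr2 sqrtCK [u *m _]mx11_scalar -/r scale_scalar_mx.
  by rewrite mulVf // gt_eqF.
have [a [x' [-> ux]]] := normal x; have [b [y' [-> uy]]] := normal y.
have [c [z' [-> uz]]] := normal z; have [d [t' [-> ut]]] := normal t.
have scl u' v' (p q : 'rV[C]_n) : (p \is unitarymx \/ u' = 0) ->
    (q \is unitarymx \/ v' = 0) -> (u' *: p) *m (v' *: q)^t* = 0 ->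
    [|| u' == 0, v' == 0 | p *m q^t* == 0].
  by move=> _ _ /eqP; rewrite trmxCZ -scalemxAl -scalemxAr !scaler_eq0 conjC_eq0.
move=> /(scl _ _ _ _ ux uy) xy /(scl _ _ _ _ uz ut) zt /(scl _ _ _ _ ux uz) xz.
move=> /(scl _ _ _ _ ux ut) xt /(scl _ _ _ _ uy uz) yz /(scl _ _ _ _ uy ut) yt.
rewrite !trmxCZ -!scalemxAl -!scalemxAr !(linfunZ fl) -!scalemxAl -!scalemxAr.
have [->|a0] := eqVneq a 0; first by rewrite conjC0 scale0r.
have [->|b0] := eqVneq b 0; first by rewrite scale0r scaler0.
have [->|c0] := eqVneq c 0; first by rewrite conjC0 scale0r !scaler0.
have [->|d0] := eqVneq d 0; first by rewrite scale0r !scaler0.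
have {}ux : x' \is unitarymx by case: ux => // /eqP; rewrite (negPf a0).
have {}uy : y' \is unitarymx by case: uy => // /eqP; rewrite (negPf b0).
have {}uz : z' \is unitarymx by case: uz => // /eqP; rewrite (negPf c0).
have {}ut : t' \is unitarymx by case: ut => // /eqP; rewrite (negPf d0).
move: xy zt xz xt yz yt; rewrite (negPf a0) (negPf b0) (negPf c0) (negPf d0) /=.
move=> /eqP xy /eqP zt /eqP xz /eqP xt /eqP yz /eqP yt.
suff -> : f (x'^t* *m y') *m f (z'^t* *m t') = 0 by rewrite !scaler0.
rewrite -!conj_frame01 (frame_zero_product fH n0 Sm dm) ?frame_unitary ?mxtrace_delta //.
exact: frame_orth.
Qed.

Lemma hdiff_diagonal : exists U c, [/\ U \is unitarymx, c = 1 \/ c = -1 &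
  forall i j, f (delta_mx i i - delta_mx j j)
    = c *: conj_by U (delta_mx i i - delta_mx j j)].
Proof.
have [_ ft] := fp.
apply: (@diagonal_form _ _ (fun i j => f (delta_mx i i - delta_mx j j))) => //.
- by move=> i j l; rewrite -(linfunD fl) addrA subrK.
- by move=> i j; rewrite -fs trmxCB !trmxC_delta.
- exact: hdiff_zero.
- move=> i j ij; rewrite -eframe_pauli_z.
  exact: (frame_sq_idem fH n0 Sm dm (eframe_unitary C ij)).
- by move=> i j ij; rewrite -eframe_pauli_z; apply: (frame_trace fH (eframe_unitary C ij)).
- by move=> i j; apply: ft; rewrite raddfB /= !mxtrace_delta !eqxx subrr.
Qed.

End Preserver.

(** * Off-diagonal units once the diagonal differences are fixed *)

Section OffDiagonal.
Variables (C : numClosedFieldType) (k : nat).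
Let n := (2 + (2 + k.*2))%N.
Variable f : 'M[C]_n -> 'M[C]_n.
Hypothesis fp : inv_preserver f.
Hypothesis fd : forall i j, f (delta_mx i i - delta_mx j j) = delta_mx i i - delta_mx j j.

Let fH : inv_map f 1%:M. Proof. by case: fp. Qed.
Let fl : linear f. Proof. by case: fH. Qed.
Let fs M : f (M^t* ) = (f M)^t*. Proof. by case: fH. Qed.
Let fresh3 (i j l : 'I_n) : exists q, q \notin [:: i; j; l].
Proof. exact: exists_fresh. Qed.

Let a i j := f (delta_mx i j) i j.
Let b i j := f (delta_mx i j) j i.

Let e_frame i j (ij : i != j) := frame_ul_inv fH (eframe_unitary C ij).

Let frame_sqE i j : frame_sq f (frame (erow C i) (erow C j)) =
  (delta_mx i i - delta_mx j j) *m (delta_mx i i - delta_mx j j).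
Proof. by rewrite /frame_sq eframe_pauli_z fd. Qed.

Let anticomm i j : i != j ->
  (delta_mx i i - delta_mx j j) *m f (delta_mx i j) =
  - (f (delta_mx i j) *m (delta_mx i i - delta_mx j j)).
Proof.
move=> ij; have := inv_map_pauli_z_anticomm (e_frame ij).
by rewrite eframe_pauli_z fd eframe01.
Qed.

Let disjoint0 i j p q : uniq [:: i; j; p; q] ->
  f (delta_mx i j) *m f (delta_mx p q) = 0.
Proof.
rewrite /= !inE !negb_or -!andbA => /and5P[ij ip iq jp /and3P[jq pq _]].
rewrite -(erow_ctM C i j) -(erow_ctM C p q); apply: (zero_product fp);
  by rewrite erowM_ct ?(negPf ij, negPf ip, negPf iq, negPf jp, negPf jq, negPf pq) raddf0.
Qed.

Let diag_disjoint0 i j p q : uniq [:: i; j; p; q] ->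
  (delta_mx p p - delta_mx q q) *m f (delta_mx i j) = 0 /\
  f (delta_mx i j) *m (delta_mx p p - delta_mx q q) = 0.
Proof.
rewrite /= !inE !negb_or -!andbA => /and5P[ij ip iq jp /and3P[jq pq _]].
have tz : \tr (pauli_z C) = 0 by case: (pauli_z_inv C).
have t01 : \tr (delta_mx 0 1 : 'M[C]_2) = 0 by rewrite mxtrace_delta.
have n0 : (0 < n)%N by [].
have dm : (n <= 2 + k.*2 + 2)%N by rewrite /n; lia.
rewrite -(fd p q) -(eframe_pauli_z C p q) -(eframe01 C i j).
have [pi qi pj qj] : [/\ p != i, q != i, p != j & q != j].
  by rewrite ![_ == i]eq_sym ![_ == j]eq_sym.
split; apply: (frame_zero_product fH n0 (@min_dim_double C k) dm) => //;
  rewrite ?eframe_unitary //; apply: frame_orth;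
  by rewrite erowM_ct ?(negPf ip, negPf iq, negPf jp, negPf jq, negPf pi, negPf qi,
    negPf pj, negPf qj) raddf0.
Qed.

(** Multiplying by [E_pp - E_ll] on either side kills rows and columns outside [i, j]; anticommuting
    with [E_ii - E_jj] kills the two diagonal entries left. *)
Let shape i j : i != j ->
  f (delta_mx i j) = a i j *: delta_mx i j + b i j *: delta_mx j i.
Proof.
move=> ij; have row0 p q : p != i -> p != j -> f (delta_mx i j) p q = 0.
  move=> pi pj; have [l] := fresh3 i j p; rewrite !inE !negb_or => /and3P[li lj lp].
  have [/matrixP/(_ p q) + _] := @diag_disjoint0 i j p l ltac:(neqs).
  by rewrite mulmxBl sub_entry !mul_delta_entry (negPf lp) eqxx mul1r mul0r subr0 mxE.
have col0 p q : q != i -> q != j -> f (delta_mx i j) p q = 0.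
  move=> qi qj; have [l] := fresh3 i j q; rewrite !inE !negb_or => /and3P[li lj lq].
  have [_ /matrixP/(_ p q)] := @diag_disjoint0 i j q l ltac:(neqs).
  by rewrite mulmxBr sub_entry !mul_entry_delta (negPf lq) eqxx mulr1 mulr0 subr0 mxE.
have ac p : (p == i) || (p == j) -> f (delta_mx i j) p p = 0.
  have /eqP := anticomm ij; rewrite -addr_eq0 => /eqP/matrixP/(_ p p).
  rewrite mxE mulmxBl mulmxBr !sub_entry !mul_entry_delta !mul_delta_entry mxE.
  move=> E pij; move: E; case/orP: pij => /eqP->; rewrite !eqxx ?(negPf ij) ?(eq_sym j) ?(negPf ij).
    rewrite !mul1r !mulr1 !mul0r !mulr0 !subr0 => /eqP.
    by rewrite -mulr2n mulrn_eq0 => /eqP.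
  rewrite !mul1r !mulr1 !mul0r !mulr0 !sub0r => /eqP.
  by rewrite -mulr2n mulrn_eq0 oppr_eq0 => /eqP.
have ji : j != i by rewrite eq_sym.
have ad p q : (a i j *: delta_mx i j + b i j *: delta_mx j i) p q =
    a i j * ((p == i) && (q == j))%:R + b i j * ((p == j) && (q == i))%:R.
  by rewrite !mxE.
apply/matrixP=> p q; rewrite ad.
have [->|pi] := eqVneq p i; last have [->|pj] := eqVneq p j.
- rewrite (negPf ij) mulr0 addr0 /=.
  have [->|qj] := eqVneq q j; first by rewrite mulr1.
  by rewrite mulr0; have [->|qi] := eqVneq q i; [apply: ac; rewrite eqxx | apply: col0].
- rewrite mulr0 add0r /=; have [->|qi] := eqVneq q i; first by rewrite mulr1.
  by rewrite mulr0; have [->|qj] := eqVneq q j; [apply: ac; rewrite eqxx orbT | apply: col0].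
- by rewrite !mulr0 addr0 row0.
Qed.


Let aC i j : a j i = (a i j)^*.
Proof.
by rewrite /a -[delta_mx j i](trmxC_delta C i j) fs !mxE.
Qed.

Let mul_row1 i j (X : 'M[C]_n) q : i != j -> (f (delta_mx i j) *m X) i q = a i j * X j q.
Proof.
move=> ij; rewrite shape // mulmxDl -!scalemxAl mxE [X in X + _]mxE [X in _ + X]mxE.
by rewrite !mul_delta_entry eqxx (eq_sym j) (negPf ij) mul1r mul0r mulr0 addr0.
Qed.

Let mul_row2 i j (X : 'M[C]_n) q : i != j -> (f (delta_mx i j) *m X) j q = b i j * X i q.
Proof.
move=> ij; rewrite shape // mulmxDl -!scalemxAl mxE [X in X + _]mxE [X in _ + X]mxE.
by rewrite !mul_delta_entry eqxx (negPf ij) mul1r mul0r mulr0 add0r.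
Qed.

Let ab1 i j : i != j -> a i j * (a i j)^* + b i j * (b i j)^* = 1.
Proof.
move=> ij; have ji : j != i by rewrite eq_sym.
have := inv_map_ladder (e_frame ij); rewrite frame_sqE eframe01 eframe10.
move/matrixP/(_ i i); rewrite mxE mul_row1 // mul_row2 // -/(a j i) (aC i j).
rewrite -/(b i j) mulmxBl sub_entry !mul_delta_entry eqxx (negPf ji) mul0r subr0 mul1r.
rewrite sub_entry !mxE !eqxx (negPf ij) /= subr0 => E.
apply: etrans E; congr (_ + _).
by rewrite mulrC; congr (_ * _); rewrite /b -[delta_mx j i](trmxC_delta C i j) fs !mxE.
Qed.

(** The vectors [e_i + c e_q] and [e_q - c^* e_i] are orthogonal. Their zero product, once disjoint
    pairs are dropped, says that [c] times the product at [i] is [c^*] times the product at [q];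
    [c = 1] and [c = 'i] together force 0. *)
Let star0 i j l : uniq [:: i; j; l] -> f (delta_mx i j) *m f (delta_mx i l) = 0.
Proof.
move=> ijl; have [q] := fresh3 i j l; rewrite !inE !negb_or => /and3P[qi qj ql].
move: ijl; rewrite /= !inE !negb_or -!andbA => /and4P[ij il jl _].
have key (c : C) : c^* * c = 1 -> c *: (f (delta_mx i j) *m f (delta_mx i l)) =
    c^* *: (f (delta_mx q j) *m f (delta_mx q l)).
  move=> c1; pose x := erow C i + c *: erow C q; pose z := erow C q - c^* *: erow C i.
  have := @zero_product _ _ _ fp x (erow C j) z (erow C l).
  rewrite /x /z !trmxCD !trmxCN !trmxCZ conjCK !mulmxDl !mulmxDr !mulNmx !mulmxN.
  rewrite -!scalemxAl -!scalemxAr !erowM_ct !erow_ctM.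
  rewrite (eq_sym i q) (eq_sym j q) (eq_sym j i) !eqxx (negPf ij) (negPf il) (negPf jl).
  rewrite (negPf qi) (negPf qj) (negPf ql) raddf0 !scaler0 !subr0 addr0 sub0r addNr.
  move=> /(_ erefl erefl erefl erefl erefl erefl).
  rewrite (linfunD fl) (linfunB fl) !(linfunZ fl) mulmxDl !mulmxBr -!scalemxAl -!scalemxAr.
  rewrite (@disjoint0 i j q l) ?(@disjoint0 q j i l); try neqs.
  by rewrite sub0r !scaler0 subr0 addrC => /eqP; rewrite subr_eq0 => /eqP.
have := key 1; rewrite conjC1 mulr1 !scale1r => /(_ erefl) E1.
have := key 'i; rewrite -E1 conjCi mulNr -expr2 sqrCi opprK => /(_ erefl) /eqP.
rewrite scaleNr -addr_eq0 -mulr2n -scaler_nat scalerA scaler_eq0 mulf_eq0 pnatr_eq0.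
by rewrite (negPf (neq0Ci C)) => /eqP.
Qed.

Let ba0 i j l : uniq [:: i; j; l] -> b i j * a i l = 0.
Proof.
move=> u; have ij : i != j by move: u; rewrite /= !inE !negb_or -!andbA => /and4P[].
by have := congr1 (fun M : 'M_n => M j l) (star0 u); rewrite /= mul_row2 // mxE.
Qed.

(** By [ba0], [a i j] kills [b i q] for every other [q], so [a i q] is nonzero by [ab1]; such a [q]
    in turn kills [b i j]. *)
Let unit_a i j : i != j -> a i j != 0 -> forall l, i != l -> b i l = 0 /\ a i l != 0.
Proof.
move=> ij aij l il.
have far q : i != q -> j != q -> b i q = 0 /\ a i q != 0.
  move=> iq jq; have /eqP := @ba0 i q j ltac:(neqs).
  rewrite mulf_eq0 (negPf aij) orbF => /eqP bq; split=> //.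
  apply: contraTneq (oner_neq0 C) => aq.
  by rewrite -(ab1 iq) aq bq !mul0r addr0 eqxx.
have [jl|jl] := eqVneq j l; last exact: far.
subst l; split=> //.
have [q] := fresh3 i j j; rewrite !inE !negb_or => /and3P[qi qj _].
have [_ aq] := far q ltac:(neqs) ltac:(neqs).
have /eqP := @ba0 i j q ltac:(neqs).
by rewrite mulf_eq0 (negPf aq) orbF => /eqP.
Qed.

Lemma offdiagonal_neq0 i j : i != j ->
  f (delta_mx i j) i j != 0 \/ f (delta_mx i j) j i != 0.
Proof.
move=> ij; rewrite -/(a i j) -/(b i j).
have [a0|] := eqVneq (a i j) 0; last by left.
right; apply: contraTneq (oner_neq0 C) => b0.
by rewrite -(ab1 ij) a0 b0 !mul0r addr0 eqxx.
Qed.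

(** A nonzero [a] spreads along row [i0] by [unit_a], then to every row by conjugate symmetry, so
    all [b] vanish. The cocycle relation remains. *)
Lemma offdiagonal_form (i0 j0 : 'I_n) : i0 != j0 -> f (delta_mx i0 j0) i0 j0 != 0 ->
  exists2 W, W \is unitarymx & forall M, \tr M = 0 -> f M = W *m M *m W^t*.
Proof.
rewrite -/(a i0 j0) => ij0 a0.
have all i j : i != j -> b i j = 0.
  move=> ij; have [E|ii0] := eqVneq i i0.
    by rewrite E in ij *; case: (@unit_a _ _ ij0 a0 j ij).
  have [_ ai] := @unit_a _ _ ij0 a0 i ltac:(neqs).
  have ai0 : a i i0 != 0 by rewrite aC conjC_eq0.
  by case: (@unit_a _ _ ii0 ai0 j ij).
have fo i j : i != j -> f (delta_mx i j) = a i j *: delta_mx i j.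
  by move=> ij; rewrite shape // all // scale0r addr0.
have a1 i j : i != j -> a i j * (a i j)^* = 1.
  by move=> ij; rewrite -(ab1 ij) all // mul0r addr0.
apply: (monomial_form i0 fl fd fo) => //.
move=> l q p; rewrite /= !inE !negb_or -!andbA => /and4P[lq lp qp _].
have [r] := fresh3 l q p; rewrite !inE !negb_or => /and3P[rl rq rp].
(* [u], [z], [t] are pairwise orthogonal and orthogonal to [e_l]. The [(l, p)] entry of the
   resulting zero product is [a l p - a l q * a q p]. *)
pose u := erow C p + erow C q + erow C r; pose z := erow C p - erow C q.
pose t := erow C p + erow C q - 2 *: erow C r.
have := @zero_product _ _ _ fp (erow C l) u z t.
rewrite /u /z /t !trmxCD !trmxCN !trmxCZ !mulmxDl !mulmxDr !mulNmx !mulmxN.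
rewrite ?rmorph_nat -?scalemxAl -?scalemxAr !erowM_ct !erow_ctM.
rewrite !eqxx (negPf lq) (negPf lp) (negPf qp) (negPf rp) (negPf rq).
rewrite (eq_sym p q) (eq_sym l r) (eq_sym p r) (eq_sym q r).
rewrite (negPf qp) (negPf rp) (negPf rq) (negPf rl) => H.
refine (_ (H _ _ _ _ _ _)); last first; try by apply/matrixP=> x y; rewrite !mxE /=; ring.
  set A := (X in f X *m _); set B := (X in _ *m f X).
  have [D DE] : exists D : 'M[C]_n, D = delta_mx p p - delta_mx q q.
    by exists (delta_mx p p - delta_mx q q).
  have fD : f D = D by rewrite DE fd.
  have -> : B = D + delta_mx p q - 2 *: delta_mx p r - delta_mx q p + 2 *: delta_mx q r.
    by rewrite DE; apply/matrixP=> x y; rewrite !mxE; ring.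
  rewrite /A !(linfunD fl, linfunN fl, linfunZ fl) fD !fo //; try neqs.
  move/(congr1 (fun M : 'M_n => M l p)).
  set X := (X in _ *m X); rewrite !mulmxDl -!scalemxAl !add_entry !scale_entry.
  rewrite !mul_delta_entry eqxx !mul1r mxE /X DE !mxE !eqxx.
  rewrite ?(eq_sym p q, eq_sym q r, eq_sym p r).
  rewrite ?(negPf qp, negPf rp, negPf rq) /= => E.
  by apply/eqP; rewrite -subr_eq0 -E; apply/eqP; ring.
Qed.

End OffDiagonal.

(** * Classification of the complex-linear maps *)

Section Twist.
Variables (C : numClosedFieldType) (n : nat).

Lemma inv_preserver_twist (f : 'M[C]_n -> 'M[C]_n) (U : 'M[C]_n) c :
  U \is unitarymx -> c = 1 \/ c = -1 -> inv_preserver f ->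
  inv_preserver (fun M => c *: (U *m f M *m U^t* )).
Proof.
move=> uU c1 [[fl fs fP] ft].
have cR : c^* = c by apply/CrealP; case: c1 => ->; rewrite ?rpredN rpred1.
have cc : c * c = 1 by case: c1 => ->; rewrite ?mulrNN mulr1.
split; last first.
  move=> M /ft trM; rewrite mxtraceZ mxtrace_mulC mulmxA unitary_mulct // mul1mx.
  by rewrite trM mulr0.
split=> [x M N|M|A iA].
- by rewrite fl mulmxDr mulmxDl -scalemxAr -scalemxAl scalerDr !scalerA mulrC.
- by rewrite fs trmxCZ cR !trmxC_mul trmxCK mulmxA.
- rewrite -scalemxAl -scalemxAr scalerA cc scale1r !mulmxA.
  rewrite -(mulmxA _ (U^t* ) U) unitary_mulct // mulmx1 -(mulmxA U) fP // mulmx1.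
  exact/unitarymxP.
Qed.

Lemma untwist (X Y U : 'M[C]_n) c : U \is unitarymx -> c = 1 \/ c = -1 ->
  c *: (U *m X *m U^t* ) = Y -> X = c *: (U^t* *m Y *m U).
Proof.
move=> uU c1 <-; rewrite -scalemxAr -scalemxAl scalerA.
have -> : c * c = 1 by case: c1 => ->; rewrite ?mulrNN mulr1.
rewrite scale1r !mulmxA unitary_mulct // mul1mx -mulmxA unitary_mulct //.
by rewrite mulmx1.
Qed.

(** [tau] is the identity or transposition; the latter agrees with entrywise conjugation on
    hermitian matrices. *)
Definition unitary_form (f : 'M[C]_n -> 'M[C]_n) (tau : 'M[C]_n -> 'M[C]_n) :=
  exists U c, [/\ U \is unitarymx, c = 1 \/ c = -1 &
    forall M, \tr M = 0 -> f M = c *: (U *m tau M *m U^t* )].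

Lemma unitary_form_untwist f tau (U : 'M[C]_n) c : U \is unitarymx ->
  c = 1 \/ c = -1 -> unitary_form (fun M => c *: (U *m f M *m U^t* )) tau ->
  unitary_form f tau.
Proof.
move=> uU c1 [W [d [uW d1 fE]]]; exists (U^t* *m W), (c * d); split.
- by rewrite mul_unitarymx // trmxC_unitary.
- by case: c1 => ->; case: d1 => ->; rewrite ?mulr1 ?mul1r ?mulrNN ?mulr1; auto.
- move=> M /fE/(untwist uU c1)->; rewrite -scalemxAr -scalemxAl scalerA.
  by rewrite trmxC_mul trmxCK !mulmxA.
Qed.

End Twist.

Section Classification.
Variables (C : numClosedFieldType).

Theorem inv_preserver_ge4 k (f : 'M[C]_(2 + (2 + k.*2)) -> 'M[C]_(2 + (2 + k.*2))) :
  inv_preserver f -> unitary_form f id \/ unitary_form f trmx.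
Proof.
move=> fp; have [U [c [uU c1 fD]]] := hdiff_diagonal fp.
pose g M := c *: (U *m f M *m U^t* ).
have gp : inv_preserver g by apply: inv_preserver_twist.
have cc : c * c = 1 by case: c1 => ->; rewrite ?mulrNN mulr1.
have gd i j : g (delta_mx i i - delta_mx j j) = delta_mx i i - delta_mx j j.
  rewrite /g fD -scalemxAr -scalemxAl scalerA cc scale1r /conj_by !mulmxA.
  by rewrite (unitarymxP uU) mul1mx -mulmxA (unitarymxP uU) mulmx1.
pose i0 : 'I_(2 + (2 + k.*2)) := lshift _ (0 : 'I_2).
pose i1 : 'I_(2 + (2 + k.*2)) := lshift _ (1 : 'I_2).
have i01 : i0 != i1 by [].
have [g01|g10] := offdiagonal_neq0 gp gd i01; [left|right];
    apply: (unitary_form_untwist uU c1); rewrite -/g.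
  have [W uW gE] := offdiagonal_form gp gd i01 g01.
  by exists W, 1; split=> //; [left | move=> M /gE->; rewrite scale1r].
pose gt M := g M^T; have gtp : inv_preserver gt by apply: inv_preserver_tr.
have gtd i j : gt (delta_mx i i - delta_mx j j) = delta_mx i i - delta_mx j j.
  by rewrite /gt raddfB /= !trmx_delta gd.
have gt10 : gt (delta_mx i1 i0) i1 i0 != 0 by rewrite /gt trmx_delta.
have [W uW gE] := offdiagonal_form gtp gtd (i0 := i1) (j0 := i0) isT gt10.
exists W, 1; split=> //; first by left.
by move=> M trM; rewrite scale1r -gE ?mxtrace_tr // /gt trmxK.
Qed.

Lemma I2_cases (i : 'I_2) : i = 0 \/ i = 1.
Proof. by case: i => -[|[|//]] ?; [left|right]; apply: val_inj. Qed.

Lemma pauli_z_anticomm_diag0 (e : 'M[C]_2) p : pauli_z C *m e = - (e *m pauli_z C) -> e p p = 0.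
Proof.
move=> /eqP; rewrite -addr_eq0 => /eqP/matrixP/(_ p p).
rewrite mxE mulmxBl mulmxBr !sub_entry !mul_entry_delta !mul_delta_entry mxE.
case: (I2_cases p) => -> /=; rewrite !mul1r !mul0r !mulr1 !mulr0 ?subr0 ?sub0r => /eqP;
  by rewrite -mulr2n mulrn_eq0 ?oppr_eq0 => /eqP.
Qed.

Lemma inv_preserver2_diag (g : 'M[C]_2 -> 'M[C]_2) : inv_preserver g ->
  g (pauli_z C) = pauli_z C -> g (delta_mx 0 1) 1 0 = 0 -> unitary_form g id.
Proof.
move=> gp gz g10; have [gH gt] := gp; have [gl gs gP] := gH.
pose a i j := g (delta_mx i j) i j.
have ac := inv_map_pauli_z_anticomm gH; have lad := inv_map_ladder gH.
rewrite gz in ac.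
have shape : g (delta_mx 0 1) = a 0 1 *: delta_mx 0 1.
  rewrite [LHS]delta2_sum g10 scale0r addr0.
  by rewrite !(pauli_z_anticomm_diag0 _ ac) !scale0r add0r addr0.
have aC i j : a j i = (a i j)^*.
  by rewrite /a -[delta_mx j i](trmxC_delta C i j) gs !mxE.
have shape' : g (delta_mx 1 0) = a 1 0 *: delta_mx 1 0.
  by rewrite -[in LHS](trmxC_delta C 0 1) gs shape trmxCZ trmxC_delta -aC.
have a01 : a 0 1 * (a 0 1)^* = 1.
  have /matrixP/(_ 0 0) := lad; rewrite shape shape' -!scalemxAl -!scalemxAr.
  rewrite !mul_delta_mx !scalerA (aC 0 1) !mxE !eqxx /= mulr0 addr0 mulr1.
  by [].
have fin (i j : 'I_2) : i != j -> g (delta_mx i j) = a i j *: delta_mx i j.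
  by case: (I2_cases i) => ->; case: (I2_cases j) => ->.
have [W uW gE] : exists2 W, W \is unitarymx &
    forall M, \tr M = 0 -> g M = W *m M *m W^t*.
  apply: (monomial_form (0 : 'I_2) gl _ fin) => //.
  - move=> i j; case: (I2_cases i) => ->; case: (I2_cases j) => ->;
      rewrite ?subrr ?(linfun0 gl) //.
    by rewrite -opprB (linfunN gl) gz.
  - move=> i j; case: (I2_cases i) => ->; case: (I2_cases j) => -> // _.
    by rewrite (aC 0 1) conjCK mulrC.
  - by move=> i j l; case: (I2_cases i) => ->; case: (I2_cases j) => ->;
      case: (I2_cases l) => ->.
by exists W, 1; split=> //; [left | move=> M /gE->; rewrite scale1r].
Qed.

(** Transposition gives no separate case in size 2: conjugation by [pauli_x] with a change of sign
    fixes [pauli_z] and swaps the two off-diagonal positions. *)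
Theorem inv_preserver_2 (f : 'M[C]_2 -> 'M[C]_2) : inv_preserver f -> unitary_form f id.
Proof.
move=> fp; have [[fl fs fP] ft] := fp; have iz := pauli_z_inv C; have [hz tz zz] := iz.
(* The spectral projections of the involution [f (pauli_z C)]; their unit vectors form the basis
   that diagonalises it. *)
pose F s : 'M[C]_2 := 2^-1 *: (1%:M + s *: f (pauli_z C)).
have hfz : (f (pauli_z C))^t* = f (pauli_z C) by rewrite -fs hz.
have proj s : s = 1 \/ s = -1 -> exists2 v : 'cV[C]_2, F s = v *m v^t* & v^t* *m v = 1%:M.
  move=> s1; have sR : s^* = s by apply/CrealP; case: s1 => ->; rewrite ?rpredN rpred1.
  have ss : s * s = 1 by case: s1 => ->; rewrite ?mulrNN mulr1.
  have hR : (2^-1 : C)^* = 2^-1 by apply/CrealP; rewrite rpredV realn.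
  apply: projection_rank1.
  - by rewrite /F trmxCZ trmxCD trmxC1 trmxCZ hfz sR hR.
  - rewrite /F -scalemxAl -scalemxAr mulmxDl !mulmxDr mulmx1 mul1mx -!scalemxAl -!scalemxAr.
    rewrite fP // mulmx1 !scalerA ss scale1r.
    by apply/matrixP=> i j; rewrite !mxE; field.
  - rewrite /F mxtraceZ raddfD /= mxtrace1 mxtraceZ ft // mulr0 addr0.
    by rewrite mulVf // pnatr_eq0.
have [v Fv vv] := proj 1 (or_introl erefl); have [w Fw ww] := proj (-1) (or_intror erefl).
have vw : v^t* *m w = 0.
  have : F 1 *m F (-1) = 0.
    rewrite /F -scalemxAl -scalemxAr mulmxDl !mulmxDr mulmx1 mul1mx.
    rewrite -!scalemxAl -!scalemxAr fP // mulmx1 !scale1r !scaleN1r.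
    by rewrite addrA subrK subrr !scaler0.
  rewrite Fv Fw => /(congr1 (fun M => v^t* *m M *m w)).
  by rewrite !mulmxA vv mul1mx -mulmxA ww mulmx1 mulmx0 mul0mx.
have uU : frame (v^t* ) (w^t* ) \is unitarymx.
  by apply: frame_unitary; rewrite ?trmxCK //; apply/unitarymxP; rewrite trmxCK.
set U := frame _ _ in uU.
have fz : f (pauli_z C) = conj_by U (pauli_z C).
  rewrite conj_frame_pauli_z !trmxCK -Fv -Fw /F scale1r scaleN1r -scalerBr.
  rewrite opprD opprK addrACA subrr add0r -mulr2n -scaler_nat scalerA.
  by rewrite mulVf ?scale1r // pnatr_eq0.
apply: (unitary_form_untwist uU (or_introl erefl)).
set g := (fun M => _); have gp : inv_preserver g.
  by apply: inv_preserver_twist => //; left.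
have gz : g (pauli_z C) = pauli_z C.
  rewrite /g scale1r fz /conj_by !mulmxA.
  by rewrite (unitarymxP uU) mul1mx -mulmxA (unitarymxP uU) mulmx1.
have [g10|g10] := eqVneq (g (delta_mx 0 1) 1 0) 0.
  exact: inv_preserver2_diag.
have [gH _] := gp; have ac := inv_map_pauli_z_anticomm gH; rewrite gz in ac.
clearbody g; set e := g (delta_mx 0 1) in g10 ac.
(* The [(0, 0)] entry of [e^2 = 0] is [e 0 1 * e 1 0], so just one off-diagonal entry survives. *)
have e01 : e 0 1 = 0.
  have /matrixP/(_ 0 0) := inv_map_nilpotent gH; rewrite -/e [e in e *m _]delta2_sum.
  rewrite !(pauli_z_anticomm_diag0 _ ac) !scale0r add0r addr0 mulmxDl -!scalemxAl.
  rewrite add_entry !scale_entry !mul_delta_entry /= mul1r mul0r mulr0 addr0 mxE.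
  by move/eqP; rewrite mulf_eq0 (negPf g10) orbF => /eqP.
have eE : e = e 1 0 *: delta_mx 1 0.
  by rewrite [LHS]delta2_sum !(pauli_z_anticomm_diag0 _ ac) e01 !scale0r !add0r addr0.
have [hx _ xx] := pauli_x_inv C.
have ux : pauli_x C \is unitarymx by apply/unitarymxP; rewrite hx.
have xz : pauli_x C *m pauli_z C = - (pauli_z C *m pauli_x C) by rewrite pauli_zx opprK.
apply: (unitary_form_untwist ux (or_intror erefl)).
apply: inv_preserver2_diag; first by apply: inv_preserver_twist => //; right.
  by rewrite gz hx xz mulNmx -mulmxA xx mulmx1 scaleN1r opprK.
rewrite -/e eE hx -scalemxAr -scalemxAl !scale_entry /pauli_x; mul_delta2.
by rewrite !mul0mx !addr0 mxE /= !mulr0.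
Qed.

End Classification.

(** * Complexification *)

Section Complexification.
Variables (C : numClosedFieldType) (n : nat) (phi : 'M[C]_n.+1 -> 'M[C]_n.+1).
Let H0 (A : 'M[C]_n.+1) := A^t* = A /\ \tr A = 0.
Hypothesis phi_H0 : forall A, H0 A -> H0 (phi A).
Hypothesis phi_lin : forall a A B, a^* = a -> H0 A -> H0 B ->
  phi (a *: A + B) = a *: phi A + phi B.
Hypothesis phi_inv : forall A, herm_inv A -> herm_inv (phi A).

Let H0_lin a A B : a^* = a -> H0 A -> H0 B -> H0 (a *: A + B).
Proof.
move=> aR [hA tA] [hB tB]; split; first by rewrite trmxCD trmxCZ hA hB aR.
by rewrite raddfD /= mxtraceZ tA tB mulr0 addr0.
Qed.

(** Subtracting the scalar part brings any matrix to trace 0; then [tl M = re M + 'i im M] with both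
    parts hermitian and traceless, where [phi] is controlled. *)
Let tl (M : 'M[C]_n.+1) := M - (\tr M / n.+1%:R)%:M.
Let re (M : 'M[C]_n.+1) := 2^-1 *: (tl M + (tl M)^t* ).
Let im (M : 'M[C]_n.+1) := (- 'i / 2) *: (tl M - (tl M)^t* ).

Definition complexify M := phi (re M) + 'i *: phi (im M).

Let tl_lin c M N : tl (c *: M + N) = c *: tl M + tl N.
Proof.
rewrite /tl raddfD /= mxtraceZ mulrDl -mulrA raddfD /= -scale_scalar_mx.
by rewrite scalerBr opprD addrACA.
Qed.

Let tr_tl M : \tr (tl M) = 0.
Proof.
by rewrite /tl raddfB /= mxtrace_scalar -(mulr_natr (_ / _)) divfK ?subrr // pnatr_eq0.
Qed.

Let tr_ct (M : 'M[C]_n.+1) : \tr (M^t* ) = (\tr M)^*.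
Proof. by rewrite /mxtrace rmorph_sum; apply: eq_bigr => i _; rewrite !mxE. Qed.

Let halfR : (2^-1 : C)^* = 2^-1.
Proof. by apply/CrealP; rewrite rpredV realn. Qed.

Let re_H0 M : H0 (re M).
Proof.
split; first by rewrite /re trmxCZ trmxCD trmxCK addrC halfR.
by rewrite /re mxtraceZ raddfD /= tr_ct tr_tl conjC0 addr0 mulr0.
Qed.

Let im_H0 M : H0 (im M).
Proof.
split; last by rewrite /im mxtraceZ raddfB /= tr_ct tr_tl conjC0 subr0 mulr0.
rewrite /im trmxCZ trmxCB trmxCK.
have -> : (- 'i / 2 : C)^* = 'i / 2.
  by rewrite rmorphM rmorphN fmorphV rmorph_nat /= conjCi opprK.
by rewrite -[LHS]opprK -scalerN opprB mulNr scaleNr.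
Qed.

Let tl_ct M : tl (M^t* ) = (tl M)^t*.
Proof.
rewrite /tl trmxCB tr_ct; congr (_ - _); apply/matrixP=> i j; rewrite !mxE eq_sym.
by case: eqP; rewrite ?mulr1n ?mulr0n ?conjC0 // rmorphM fmorphV rmorph_nat.
Qed.

Let phi0 : phi 0 = 0.
Proof.
have h0 : H0 0 by split; rewrite ?trmxC0 ?mxtrace0.
have := phi_lin (conjC1 C) h0 h0; rewrite !scale1r addr0 => E.
by apply: (addIr (phi 0)); rewrite add0r -E.
Qed.

Let phi_lin3 a b X Y Z : a^* = a -> b^* = b -> H0 X -> H0 Y -> H0 Z ->
  phi (a *: X + (b *: Y + Z)) = a *: phi X + (b *: phi Y + phi Z).
Proof. by move=> aR bR hX hY hZ; rewrite !phi_lin //; apply: H0_lin. Qed.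

Lemma complexify_linear : linear complexify.
Proof.
move=> c M N; pose a := 'Re c; pose b := 'Im c.
have aR : a^* = a by apply/CrealP; apply: Creal_Re.
have bR : b^* = b by apply/CrealP; apply: Creal_Im.
have bNR : (- b)^* = - b by rewrite rmorphN /= bR.
have cE : c = a + 'i * b by apply: Crect.
have cC : c^* = a - 'i * b by rewrite cE rmorphD rmorphM /= aR bR conjCi mulNr.
have i0 : 'i != 0 :> C := neq0Ci C.
have reE : re (c *: M + N) = a *: re M + ((- b) *: im M + re N).
  rewrite /re /im tl_lin trmxCD trmxCZ cC cE; move: (tl M) (tl N) => T S.
  by apply/matrixP=> i j; rewrite !mxE; field.
(* Writing [b] as [- ('i * 'i) * b] turns the goals below into identities that hold with ['i] as an
   indeterminate. *)
have iib X : b *: X = (- ('i * 'i) * b) *: X :> 'M[C]_n.+1.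
  by rewrite -expr2 sqrCi opprK mul1r.
have iibN X : (- b) *: X = ('i * 'i * b) *: X :> 'M[C]_n.+1.
  by rewrite -expr2 sqrCi mulN1r.
have imE : im (c *: M + N) = a *: im M + (b *: re M + im N).
  rewrite iib /re /im tl_lin trmxCD trmxCZ cC cE; move: (tl M) (tl N) => T S.
  by apply/matrixP=> i j; rewrite !mxE; field.
rewrite /complexify reE imE !phi_lin3 // cE iibN.
move: (phi (re M)) (phi (im M)) (phi (re N)) (phi (im N)) => A B D E.
by apply/matrixP=> i j; rewrite !mxE; ring.
Qed.

Lemma complexify_ct M : complexify (M^t* ) = (complexify M)^t*.
Proof.
have imNE : im (M^t* ) = (-1) *: im M + 0.
  rewrite /im tl_ct trmxCK; move: (tl M) ((tl M)^t* ) => T S.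
  by apply/matrixP=> i j; rewrite !mxE; ring.
have reE : re (M^t* ) = re M by rewrite /re tl_ct trmxCK addrC.
have n1 : (-1 : C)^* = -1 by rewrite rmorphN /= conjC1.
have h0 : H0 0 by split; rewrite ?trmxC0 ?mxtrace0.
rewrite /complexify reE imNE phi_lin // phi0 addr0 trmxCD trmxCZ conjCi.
have [-> _] := phi_H0 (re_H0 M); have [-> _] := phi_H0 (im_H0 M).
by rewrite scaleN1r scalerN scaleNr.
Qed.

Lemma complexifyE A : H0 A -> complexify A = phi A.
Proof.
move=> [hA tA]; have tlA : tl A = A by rewrite /tl tA mul0r raddf0 subr0.
rewrite /complexify /re /im tlA hA subrr scaler0 phi0 scaler0 addr0.
by rewrite -mulr2n -scaler_nat scalerA mulVf ?scale1r // pnatr_eq0.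
Qed.

Lemma complexify_preserver : inv_preserver complexify.
Proof.
split; last first.
  move=> M _; have [_ tr1] := phi_H0 (re_H0 M); have [_ tr2] := phi_H0 (im_H0 M).
  by rewrite /complexify raddfD /= mxtraceZ tr1 tr2 mulr0 addr0.
split; [exact: complexify_linear | exact: complexify_ct | move=> A iA].
have [hA tA _] := iA; rewrite complexifyE //.
by have [_ _] := phi_inv iA.
Qed.


End Complexification.

(** * The equivalence for real-linear maps *)

Section Main.
Variable R : realType.
Let C : numClosedFieldType := R[i].

Lemma hermsymmxE n (A : 'M[C]_n) : (A \is hermsymmx) = (A^t* == A).
Proof. by rewrite is_hermitianmxE expr0 scale1r eq_sym. Qed.

Lemma herm0E n (A : 'M[C]_n) : herm0 A <-> A^t* = A /\ \tr A = 0.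
Proof. by rewrite /herm0 hermsymmxE; split=> -[/eqP hA tA]; split=> //; apply/eqP. Qed.

Lemma iherm0E n (A : 'M[C]_n) : iherm0 A <-> herm_inv A.
Proof.
rewrite /iherm0 herm0E; split=> [[[hA tA] /unitarymxP]|[hA tA AA]].
  by rewrite hA.
by split=> //; apply/unitarymxP; rewrite hA.
Qed.

Lemma entconjmx_herm n (A : 'M[C]_n) : herm0 A -> entconjmx A = A^T.
Proof.
move/herm0E=> [hA _]; rewrite -[in RHS]hA.
by apply/matrixP=> i j; rewrite !mxE.
Qed.

Lemma real_complex_conj (a : R) : ((a%:C)%C : C)^* = (a%:C)%C.
Proof. by apply/CrealP; rewrite complex_real. Qed.

Lemma preserver_unitary_form k (phi : 'M[C]_(k.*2) -> 'M[C]_(k.*2)) :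
  (forall A, herm0 A -> herm0 (phi A)) ->
  (forall (a : R) (A B : 'M[C]_(k.*2)), herm0 A -> herm0 B ->
    phi ((a%:C)%C *: A + B) = (a%:C)%C *: phi A + phi B) ->
  (forall A, iherm0 A -> iherm0 (phi A)) ->
  exists (U : 'M[C]_(k.*2)) (s : C),
     U \is unitarymx /\ (s = 1 \/ s = -1) /\
     ((forall A, herm0 A -> phi A = s *: (U *m A *m ctrmx U)) \/
      ((2 <= k)%N /\
       forall A, herm0 A -> phi A = s *: (U *m entconjmx A *m ctrmx U))).
Proof.
(* For [k = 0] the only matrix is the empty one. Otherwise the size is positive, as the trace
   normalisation in [complexify] requires. *)
case: k phi => [|k] phi pH pl pI.
  exists 1%:M, 1; split; first by apply/unitarymxP; rewrite trmxC1 mulmx1.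
  by split; [left | left=> A _; apply/matrixP=> -[]].
have pH' (A : 'M[C]_(k.+1.*2)) : A^t* = A /\ \tr A = 0 ->
    (phi A)^t* = phi A /\ \tr (phi A) = 0.
  by move/herm0E/pH/herm0E.
have pl' (a : C) (A B : 'M[C]_(k.+1.*2)) : a^* = a -> A^t* = A /\ \tr A = 0 ->
    B^t* = B /\ \tr B = 0 -> phi (a *: A + B) = a *: phi A + phi B.
  move=> /CrealP/RRe_real <- /herm0E hA /herm0E hB; exact: pl.
have pI' (A : 'M[C]_(k.+1.*2)) : herm_inv A -> herm_inv (phi A).
  by move/iherm0E/pI/iherm0E.
pose f := @complexify C (k.*2).+1 phi.
have fp : inv_preserver f := complexify_preserver pH' pl' pI'.
have fE A : herm0 A -> f A = phi A.
  by move/herm0E=> hA; apply: (complexifyE pl').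
case: k phi pH pl pI pH' pl' pI' f fp fE => [|k] phi pH pl pI pH' pl' pI' f fp fE.
  have [U [c [uU c1 fU]]] := inv_preserver_2 fp.
  exists U, c; split=> //; split=> //; left=> A hA.
  by rewrite -fE // fU //; have [] := hA.
have [[U [c [uU c1 fU]]]|[U [c [uU c1 fU]]]] := inv_preserver_ge4 fp;
    exists U, c; split=> //; split=> //; [left|right; split=> //] => A hA.
  by rewrite -fE // fU //; have [] := hA.
by rewrite -fE // fU ?entconjmx_herm //; have [] := hA.
Qed.

(** Covers both alternatives of the converse, with [tau] the identity or entrywise conjugation; the
    latter is linear only over real scalars. *)
Lemma unitary_form_preserver n (U : 'M[C]_n) (s : C) (tau : 'M[C]_n -> 'M[C]_n)
    (phi : 'M[C]_n -> 'M[C]_n) :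
  U \is unitarymx -> s = 1 \/ s = -1 ->
  (forall a A B, a^* = a -> tau (a *: A + B) = a *: tau A + tau B) ->
  (forall A, A \is unitarymx -> tau A \is unitarymx) ->
  (forall A, herm0 A -> herm0 (phi A)) ->
  (forall A, herm0 A -> phi A = s *: (U *m tau A *m ctrmx U)) ->
  (forall (a : R) (A B : 'M[C]_n), herm0 A -> herm0 B ->
    phi ((a%:C)%C *: A + B) = (a%:C)%C *: phi A + phi B) /\
  (forall A, iherm0 A -> iherm0 (phi A)).
Proof.
move=> uU s1 tauL tauU pH pE; split=> [a A B hA hB|A [hA uA]].
  rewrite !pE // ?tauL ?real_complex_conj //.
    rewrite mulmxDr mulmxDl -scalemxAr -scalemxAl scalerDr !scalerA.
    by rewrite [s * _]mulrC.
  move: hA hB => /herm0E[hA tA] /herm0E[hB tB]; apply/herm0E; split.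
    by rewrite trmxCD trmxCZ hA hB real_complex_conj.
  by rewrite raddfD /= mxtraceZ tA tB mulr0 addr0.
split; first exact: pH.
have uV : U *m tau A *m ctrmx U \is unitarymx.
  by rewrite !mul_unitarymx ?tauU // trmxC_unitary.
rewrite pE //; apply/unitarymxP; rewrite trmxCZ -scalemxAl -scalemxAr.
rewrite (unitarymxP uV) scalerA.
by case: s1 => ->; rewrite ?rmorphN /= conjC1 ?mulrNN mulr1 scale1r.
Qed.

End Main.

Local Close Scope sesquilinear_scope.
Unset Implicit Arguments.

(* phi : H_{2k}^0 -> H_{2k}^0 is modelled as a map on all matrices
   that sends H_{2k}^0 into itself; only its values on H_{2k}^0 matter. *)
Theorem theorem3p13 (R : realType) (k : nat)
  (phi : 'M[R[i]]_(k.*2) -> 'M[R[i]]_(k.*2))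
  (phi_H0 : forall A, herm0 A -> herm0 (phi A)) :
  ((forall (a : R) (A B : 'M[R[i]]_(k.*2)), herm0 A -> herm0 B ->
       phi ((a%:C)%C *: A + B) = (a%:C)%C *: phi A + phi B) /\
   (forall A, iherm0 A -> iherm0 (phi A)))
  <->
  (exists (U : 'M[R[i]]_(k.*2)) (s : R[i]),
     U \is unitarymx /\ (s = 1 \/ s = -1) /\
     ((forall A, herm0 A -> phi A = s *: (U *m A *m ctrmx U)) \/
      ((2 <= k)%N /\
       forall A, herm0 A -> phi A = s *: (U *m entconjmx A *m ctrmx U)))).
Proof.
split=> [[phi_lin phi_inv]|[U [s [uU [s1 [phiE|[_ phiE]]]]]]].
- exact: preserver_unitary_form.
- exact: (unitary_form_preserver uU s1 _ _ phi_H0 phiE).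
- apply: (unitary_form_preserver uU s1 _ _ phi_H0 phiE) => [a A B aR|A uA].
    by rewrite /entconjmx map_mxD map_mxZ /= aR.
  by rewrite conjC_unitary.
Qed.
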